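(* Let $\mathsf{G}$ be a smooth étale Leray groupoid with loop groupoid $\mathsf{L}\mathsf{G}$. There is a homomorphism, natural in $\mathsf{G}$, $$\tau_1:\breve{C}^1(\mathsf{G},\mathbb{C}^\times(2)_{\mathsf{G}})\longrightarrow \breve{C}^0(\mathsf{L}\mathsf{G},\mathbb{C}^\times_{\mathsf{L}\mathsf{G}})$$ that associates to every line bundle with connection over $\mathsf{G}$ (i.e. to every 1-cocycle $(h,A)$ of $\breve{C}^*(\mathsf{G},\mathbb{C}^\times(2)_{\mathsf{G}})$) its holonomy, that is, the function $$H(\psi)=\exp\Big(\sum_{i=1}^n\int_{I_i}\psi_i^*A\Big)\prod_{i=1}^n h(\psi(\alpha_i))^{-1},$$ $\psi$ being an object of $\mathsf{L}\mathsf{G}(W)$ for a partition $W=\{0=\alpha_0<\dots<\alpha_n=1\}$. This map descends to cohomology: it sends 1-cocycles to 0-cocycles and 1-coboundaries to the constant function $1$, and hence induces a homomorphism $$\mathbb{H}^1\big(\mathsf{G},\ \mathbb{C}^\times_{\mathsf{G}}\xrightarrow{d\log}\mathcal{A}^1_{\mathsf{G},\mathbb{C}}\big)\longrightarrow H^0(\mathsf{L}\mathsf{G},\mathbb{C}^\times_{\mathsf{L}\mathsf{G}}).$$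
   Context: **Groupoids.** A smooth étale groupoid $\mathsf{G}$ is a groupoid whose objects $\mathsf{G}_0$ and arrows $\mathsf{G}_1$ form manifolds and all of whose structure maps (source $\mathsf{s}$, target $\mathsf{t}$, identity $\mathsf{e}$, inverse $\mathsf{i}$, composition $\mathsf{m}$) are local diffeomorphisms. For $g_1:x\to y$, $g_2:y\to z$ the composite is written $g_1g_2=g_1\cdot g_2$. $\mathsf{G}_k$ is the manifold of composable strings $(g_1,\dots,g_k)$, $\mathsf{t}(g_i)=\mathsf{s}(g_{i+1})$. $\mathsf{G}$ is Leray if every $\mathsf{G}_k$ is diffeomorphic to a disjoint union of contractible open sets. **Čech complex.** $C^{k,0}$ is the (multiplicative) group of smooth functions $\mathsf{G}_k\to\mathbb{C}^\times$, and $C^{k,l}=\Omega^l(\mathsf{G}_k)\otimes\mathbb{C}$ for $l\ge1$. The face maps $\varrho_0,\dots,\varrho_{k+1}:\mathsf{G}_{k+1}\to\mathsf{G}_k$ are: $\varrho_0$ omits $g_1$, $\varrho_{k+1}$ omits $g_{k+1}$, $\varrho_l$ ($0<l<k+1$) replaces $g_l,g_{l+1}$ by $g_lg_{l+1}$; for $k=0$, $\varrho_0=\mathsf{t}$, $\varrho_1=\mathsf{s}$. $\delta=\sum_l(-1)^l\varrho_l^*$ (multiplicatively for $l=0$ forms). The other differential is $d\log:C^{k,0}\to C^{k,1}$ and exterior $d:C^{k,l}\to C^{k,l+1}$, $l\geq 1$. $\mathbb{C}^\times(p)_{\mathsf{G}}$ is the complex of sheaves $\mathbb{C}^\times_{\mathsf{G}}\xrightarrow{d\log}\mathcal{A}^1_{\mathsf{G},\mathbb{C}}\xrightarrow{d}\cdots\xrightarrow{d}\mathcal{A}^{p-1}_{\mathsf{G},\mathbb{C}}$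 ($\mathbb{C}^\times_{\mathsf G}$: smooth $\mathbb{C}^\times$-valued functions; $\mathcal{A}^l$: complex $l$-forms), and $\breve{C}^m(\mathsf{G},\mathbb{C}^\times(p)_{\mathsf{G}})=\bigoplus_{0\le l\le \min(m,p-1)}C^{m-l,l}$ with coboundary $\delta+(-1)^{m+1}d$ on degree $m$ (so $\delta-d$ on degree $0$, $\delta+d$ on degree $1$; components of form degree $\geq p$ are dropped). For $\mathsf{G}$ Leray its cohomology is the hypercohomology $\mathbb{H}^*(\mathsf{G},\mathbb{C}^\times(p)_{\mathsf{G}})$. Thus $(h,A)\in\breve{C}^1(\mathsf{G},\mathbb{C}^\times(2)_{\mathsf{G}})$ consists of $h:\mathsf{G}_1\to\mathbb{C}^\times$ and $A\in\Omega^1(\mathsf{G}_0)\otimes\mathbb{C}$; it is a 1-cocycle iff $h(g_1g_2)=h(g_1)h(g_2)$ and $\mathsf{t}^*A-\mathsf{s}^*A=-d\log h$; the 1-coboundaries are $(\delta f,-d\log f)$ with $f:\mathsf{G}_0\to\mathbb{C}^\times$ smooth. **Loop groupoid.** For a partition $W=\{0=\alpha_0<\alpha_1<\dots<\alpha_n=1\}$ put $I_i=[\alpha_{i-1},\alpha_i]$. An object $\psi$ of $\mathsf{L}\mathsf{G}(W)$ consists of smooth maps $\psi_i:I_i\to\mathsf{G}_0$ and arrows $\psi(\alpha_i)\in\mathsf{G}_1$ ($1\le i\le n$) with $\mathsf{s}(\psi(\alpha_i))=\psi_i(\alpha_i)$, $\mathsf{t}(\psi(\alpha_i))=\psi_{i+1}(\alpha_i)$,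 where for $i=n$ one reads $\psi_{n+1}(\alpha_n):=\psi_1(\alpha_0)$; moreover the germ of local diffeomorphism of $\mathsf{G}_0$ defined by the arrow $\psi(\alpha_i)$ carries $\psi_i$ to a path that fits smoothly at $\alpha_i$ with $\psi_{i+1}$ (with $\psi_1(\cdot-1)$ if $i=n$). An arrow $\Lambda:\psi\to\phi$ consists of smooth maps $\Lambda_i:I_i\to\mathsf{G}_1$ with $\mathsf{s}\Lambda_i=\psi_i$, $\mathsf{t}\Lambda_i=\phi_i$ and $\Lambda_i(\alpha_i)\cdot\phi(\alpha_i)=\psi(\alpha_i)\cdot\Lambda_{i+1}(\alpha_i)$, with $\Lambda_{n+1}(\alpha_n):=\Lambda_1(\alpha_0)$. Composition is pointwise. Inserting a new point $\beta\in(\alpha_{i-1},\alpha_i)$ into $W$, restricting the maps and setting $\psi(\beta):=\mathsf{e}(\psi_i(\beta))$ gives an inclusion $\mathsf{L}\mathsf{G}(W)\hookrightarrow\mathsf{L}\mathsf{G}(W')$, and $\mathsf{L}\mathsf{G}$ is the union (colimit) of the $\mathsf{L}\mathsf{G}(W)$ over all $W$. **Functions on the loop groupoid.** A smooth family of objects parametrized by an open $U\subset\mathbb{R}^r$ is one for which $(u,t)\mapsto\psi^u_i(t)$ and $u\mapsto\psi^u(\alpha_i)$ are smooth. $\breve{C}^0(\mathsf{L}\mathsf{G},\mathbb{C}^\times_{\mathsf{L}\mathsf{G}})$ is the group of $\mathbb{C}^\times$-valued functions on the objects of $\mathsf{L}\mathsf{G}$ that are smooth along smooth families; a 0-cocycle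 is such a function $H$ with $H(\psi)=H(\phi)$ whenever there is an arrow $\psi\to\phi$, and $H^0(\mathsf{L}\mathsf{G},\mathbb{C}^\times_{\mathsf{L}\mathsf{G}})$ is the group of 0-cocycles. Naturality means: a smooth functor $\Phi:\mathsf{G}'\to\mathsf{G}$ of Leray groupoids induces $\mathsf{L}\Phi:\mathsf{L}\mathsf{G}'\to\mathsf{L}\mathsf{G}$, and $\tau_1\circ\Phi^*=(\mathsf{L}\Phi)^*\circ\tau_1$. *)

(* Defs.v *)
From HB Require Import structures.
From mathcomp Require Import all_boot all_order all_algebra.
From mathcomp Require Import complex.
From mathcomp Require Import all_classical all_reals all_analysis.

Set Implicit Arguments.
Unset Strict Implicit.
Unset Printing Implicit Defensive.

Import Order.TTheory GRing.Theory Num.Theory.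
Import numFieldNormedType.Exports.

Local Open Scope classical_set_scope.
Local Open Scope ring_scope.
Local Open Scope complex_scope.

Section Calculus.
Context {R : realType}.

(* [f] is of class C^k on [U]; meant for [U] open. *)
Fixpoint Ck {V W : normedModType R} (k : nat) (U : set V) (f : V -> W) : Prop :=
  match k with
  | 0 => forall x, U x -> {for x, continuous f}
  | k'.+1 => (forall x, U x -> differentiable f x) /\
             forall v, Ck k' U (fun x => 'D_v f x)
  end.

Definition smooth_on {V W : normedModType R} (U : set V) (f : V -> W) : Prop :=
  forall k, Ck k U f.

Definition csmooth_on {V : normedModType R} (U : set V) (f : V -> R[i]) : Prop :=
  smooth_on U (fun x => complex.Re (f x) : R^o) /\
  smooth_on U (fun x => complex.Im (f x) : R^o).

Definition cderive {V : normedModType R} (f : V -> R[i]) (x v : V) : R[i] :=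
  ('D_v (fun y => complex.Re (f y) : R^o) x) +i*
  ('D_v (fun y => complex.Im (f y) : R^o) x).

Definition cexp (z : R[i]) : R[i] :=
  (expR (complex.Re z) * cos (complex.Im z)) +i*
  (expR (complex.Re z) * sin (complex.Im z)).

Definition cintegral (a b : R) (f : R -> R[i]) : R[i] :=
  (\int[lebesgue_measure]_(t in `[a, b]) complex.Re (f t)) +i*
  (\int[lebesgue_measure]_(t in `[a, b]) complex.Im (f t)).

Definition contractible {X : topologicalType} (U : set X) : Prop :=
  exists x0, U x0 /\ exists F : R * X -> X,
    [/\ {within `[0, 1] `*` U, continuous F},
        (forall t x, t \in `[0, 1] -> U x -> U (F (t, x))),
        (forall x, U x -> F (0, x) = x) &
        (forall x, U x -> F (1, x) = x0)].

End Calculus.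

(* A chart comes with an inverse; only the values of [cmap] on [cdom] and
   those of [cinv] on [cimg] are meaningful. *)
Record chart (R : realType) (d : nat) (X : topologicalType) := Chart {
  cdom : set X;
  cmap : X -> 'rV[R]_d;
  cinv : 'rV[R]_d -> X }.

Definition cimg {R d X} (c : @chart R d X) : set 'rV[R]_d := cmap c @` cdom c.

Definition is_chart {R d X} (c : @chart R d X) : Prop :=
  [/\ open (cdom c), open (cimg c),
      (forall x, cdom c x -> cinv c (cmap c x) = x),
      {within cdom c, continuous (cmap c)} &
      {within cimg c, continuous (cinv c)}].

(* A space with a set of charts; [is_manifold] says that it is an atlas. *)
Record smooth_space (R : realType) (d : nat) := SmoothSpace {
  mtop :> topologicalType;
  atlas : set (chart R d mtop) }.

Definition is_manifold {R d} (M : smooth_space R d) : Prop :=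
  [/\ hausdorff_space M,
      @second_countable M,
      (forall c, atlas (s := M) c -> is_chart c),
      (forall x : M, exists2 c, atlas c & cdom c x) &
      (forall c c' : chart R d M, atlas c -> atlas c' ->
         smooth_on (cmap c @` (cdom c `&` cdom c')) (cmap c' \o cinv c))].

(* A chart of [M] around [x], when there is one. *)
Definition chart_at {R d} {M : smooth_space R d} (x : M) : chart R d M :=
  if pselect (exists c : chart R d M, atlas c /\ cdom c x) is left e
  then projT1 (cid e) else Chart set0 (fun=> 0) (fun=> x).

Definition euclidean (R : realType) (d : nat) : smooth_space R d :=
  @SmoothSpace R d 'rV[R]_d [set Chart setT id id].

(* The charts of [X] read through [p] as charts of [M]: for [p] a local
   homeomorphism, the only smooth structure making [p] a local
   diffeomorphism. *)
Definition etale_space {R d} (X : topologicalType) (M : smooth_space R d)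
    (p : X -> M) : smooth_space R d :=
  @SmoothSpace R d X [set c | is_chart c /\
    exists2 c', atlas c' & forall x, cdom c x ->
      cdom c' (p x) /\ cmap c x = cmap c' (p x)].

Section Maps.
Context {R : realType}.

Definition smooth_map_on {d e} {M : smooth_space R d} {N : smooth_space R e}
    (U : set M) (f : M -> N) : Prop :=
  (forall x, U x -> {for x, continuous f}) /\
  forall c c', atlas c -> atlas c' ->
    smooth_on (cmap c @` (U `&` cdom c `&` f @^-1` cdom c'))
              (cmap c' \o f \o cinv c).

Definition smooth_map {d e} {M : smooth_space R d} {N : smooth_space R e}
    (f : M -> N) : Prop := smooth_map_on setT f.

Definition diffeomorphic {d e} (M : smooth_space R d) (N : smooth_space R e) :
    Prop :=
  exists (f : M -> N) (g : N -> M),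
    [/\ smooth_map f, smooth_map g, cancel f g & cancel g f].

Definition local_diffeo {d e} {M : smooth_space R d} {N : smooth_space R e}
    (f : M -> N) : Prop :=
  forall x, exists U, exists g : N -> M,
    [/\ open U /\ U x, open (f @` U), smooth_map_on U f,
        smooth_map_on (f @` U) g & forall y, U y -> g (f y) = y].

Definition csmooth {d} {M : smooth_space R d} (f : M -> R[i]) : Prop :=
  forall c, atlas c -> csmooth_on (cimg c) (f \o cinv c).

(* Smoothness of a map defined on an arbitrary subset [S] of a normed space:
   near each point of [S] it extends to a smooth map on an open set. *)
Definition smooth_into {V : normedModType R} {d} {M : smooth_space R d}
    (S : set V) (f : V -> M) : Prop :=
  forall x, S x -> exists c, exists O : set V, exists g : V -> 'rV[R]_d,
    [/\ atlas c, open O /\ O x, smooth_on O g &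
        forall y, S y -> O y -> cdom c (f y) /\ cmap c (f y) = g y].

End Maps.

(* The disjoint union of a family of (open) subsets of R^d. *)
Definition disjoint_union {R : realType} {d} (I : choiceType)
    (U : I -> set 'rV[R]_d) : smooth_space R d :=
  @etale_space R d {i : I & set_type (U i)} (euclidean R d)
    (fun x => set_val (projT2 x)).

Definition union_of_contractibles {R d} (M : smooth_space R d) : Prop :=
  exists (I : choiceType) (U : I -> set 'rV[R]_d),
    (forall i, open (U i) /\ contractible (R := R) (U i)) /\
    diffeomorphic M (disjoint_union U).

(* [A c x] is the row of components of the covector at [x] in the chart [c];
   it is meaningful for [c] in the atlas and [x] in the domain of [c]. *)
Definition form1 {R d} (M : smooth_space R d) : Type :=
  chart R d M -> M -> 'rV[R[i]]_d.

Section Forms.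
Context {R : realType}.

Definition pairing {d} (a : 'rV[R[i]]_d) (v : 'rV[R]_d) : R[i] :=
  \sum_(j < d) a 0 j * (v 0 j)%:C.

Definition pullback {d e} {M : smooth_space R d} {N : smooth_space R e}
    (f : M -> N) (A : form1 N) : form1 M :=
  fun c x => let c' := chart_at (f x) in
    \row_j pairing (A c' (f x))
             ('D_(delta_mx 0 j) (cmap c' \o f \o cinv c) (cmap c x)).

Definition dlog {d} {M : smooth_space R d} (f : M -> R[i]) : form1 M :=
  fun c x => \row_j ((f x)^-1 * cderive (f \o cinv c) (cmap c x) (delta_mx 0 j)).

Definition form_eq {d} {M : smooth_space R d} (A B : form1 M) : Prop :=
  forall c x, atlas c -> cdom c x -> A c x = B c x.

Definition is_form1 {d} {M : smooth_space R d} (A : form1 M) : Prop :=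
  (forall c j, atlas c -> csmooth_on (cimg c) (fun y => A c (cinv c y) 0 j)) /\
  (forall c c' x j, atlas c -> atlas c' -> cdom c x -> cdom c' x ->
     A c x 0 j = pairing (A c' x)
                   ('D_(delta_mx 0 j) (cmap c' \o cinv c) (cmap c x))).

(* The integral over [a, b] of the pullback of [A] along the path [p]. The
   values of [p] outside [a, b] affect the derivative at most at the end
   points, hence do not affect the integral. *)
Definition path_integral {d} {M : smooth_space R d} (A : form1 M)
    (a b : R) (p : R -> M) : R[i] :=
  cintegral a b (fun t => let c := chart_at (p t) in
    pairing (A c (p t)) (derive1 (cmap c \o p) t)).

End Forms.

(* Composable strings (g_0, ..., g_k) of k+1 arrows; the first projection is
   étale since the source map is. *)
Definition strings {R d} {M0 M1 : smooth_space R d} (s t : M1 -> M0) (k : nat) :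
    smooth_space R d :=
  @etale_space R d
    (set_type [set g : prod_topology (fun _ : 'I_k.+1 => M1) |
       forall i j : 'I_k.+1, j = i.+1 :> nat -> t (g i) = s (g j)])
    M1 (fun g => set_val g ord0).

(* [gcmp g1 g2] is g1 followed by g2, meaningful when [gtgt g1 = gsrc g2]. *)
Record etale_groupoid (R : realType) (d : nat) := EtaleGroupoid {
  ob : smooth_space R d;
  ar : smooth_space R d;
  gsrc : ar -> ob;
  gtgt : ar -> ob;
  gid : ob -> ar;
  ginv : ar -> ar;
  gcmp : ar -> ar -> ar;
  ob_manifold : is_manifold ob;
  ar_manifold : is_manifold ar;
  gsrc_etale : local_diffeo gsrc;
  gtgt_etale : local_diffeo gtgt;
  gid_etale : local_diffeo gid;
  ginv_etale : local_diffeo ginv;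
  gcmp_etale : local_diffeo
    (fun g : strings gsrc gtgt 1 => gcmp (set_val g ord0) (set_val g ord_max));
  gsrc_id : forall x, gsrc (gid x) = x;
  gtgt_id : forall x, gtgt (gid x) = x;
  gsrc_inv : forall g, gsrc (ginv g) = gtgt g;
  gtgt_inv : forall g, gtgt (ginv g) = gsrc g;
  gsrc_cmp : forall g1 g2, gtgt g1 = gsrc g2 -> gsrc (gcmp g1 g2) = gsrc g1;
  gtgt_cmp : forall g1 g2, gtgt g1 = gsrc g2 -> gtgt (gcmp g1 g2) = gtgt g2;
  gcmpA : forall g1 g2 g3, gtgt g1 = gsrc g2 -> gtgt g2 = gsrc g3 ->
    gcmp g1 (gcmp g2 g3) = gcmp (gcmp g1 g2) g3;
  gcmp1g : forall g, gcmp (gid (gsrc g)) g = g;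
  gcmpg1 : forall g, gcmp g (gid (gtgt g)) = g;
  gcmpgV : forall g, gcmp g (ginv g) = gid (gsrc g);
  gcmpVg : forall g, gcmp (ginv g) g = gid (gtgt g) }.

Definition nerve {R d} (G : etale_groupoid R d) (k : nat) : smooth_space R d :=
  if k is k'.+1 then strings (gsrc (e := G)) (gtgt (e := G)) k' else ob G.

Definition leray {R d} (G : etale_groupoid R d) : Prop :=
  forall k, union_of_contractibles (nerve G k).

Record smooth_functor {R d' d} (G' : etale_groupoid R d')
    (G : etale_groupoid R d) := SmoothFunctor {
  fob : ob G' -> ob G;
  far : ar G' -> ar G;
  fob_smooth : smooth_map fob;
  far_smooth : smooth_map far;
  far_src : forall g, gsrc (far g) = fob (gsrc g);
  far_tgt : forall g, gtgt (far g) = fob (gtgt g);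
  far_id : forall x, far (gid x) = gid (fob x);
  far_cmp : forall g1 g2, gtgt g1 = gsrc g2 ->
    far (gcmp g1 g2) = gcmp (far g1) (far g2) }.

(* The groups of cochains are given by predicates on types of raw data: a pair
   (h, A) of degree 1, and the group law of such pairs. *)
Section Cech.
Context {R : realType} {d : nat} (G : etale_groupoid R d).

Definition pre_cech1 : Type := (ar G -> R[i]) * form1 (ob G).

Definition cech1_mul (c c' : pre_cech1) : pre_cech1 :=
  (fun g => c.1 g * c'.1 g, fun ch x => c.2 ch x + c'.2 ch x).

Definition cech0 : set (ob G -> R[i]) :=
  [set f | csmooth f /\ forall x, f x != 0].

Definition cech1 : set pre_cech1 :=
  [set c | [/\ csmooth c.1, (forall g, c.1 g != 0) & is_form1 c.2]].

(* delta - d log *)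
Definition cech_d0 (f : ob G -> R[i]) : pre_cech1 :=
  (fun g => f (gtgt g) * (f (gsrc g))^-1, fun c x => - dlog f c x).

(* delta + d; the first component is meaningful on composable pairs *)
Definition cech_d1 (c : pre_cech1) : (ar G -> ar G -> R[i]) * form1 (ar G) :=
  (fun g1 g2 => c.1 g2 * (c.1 (gcmp g1 g2))^-1 * c.1 g1,
   fun ch g => pullback (gtgt (e := G)) c.2 ch g
               - pullback (gsrc (e := G)) c.2 ch g + dlog c.1 ch g).

Definition cocycle1 : set pre_cech1 :=
  [set c | [/\ cech1 c,
     (forall g1 g2, gtgt g1 = gsrc g2 -> (cech_d1 c).1 g1 g2 = 1) &
     form_eq (cech_d1 c).2 (fun _ _ => 0)]].

Definition coboundary1 : set pre_cech1 :=
  [set b | exists2 f, cech0 f &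
     (forall g, b.1 g = (cech_d0 f).1 g) /\ form_eq b.2 (cech_d0 f).2].

Definition coclass (c : pre_cech1) : set pre_cech1 :=
  [set cech1_mul c b | b in coboundary1].

Definition hyper1 : set (set pre_cech1) := [set coclass c | c in cocycle1].

Definition class_mul (S T : set pre_cech1) : set pre_cech1 :=
  [set cech1_mul c c' | c in S & c' in T].

End Cech.

Definition cech1_pullback {R d' d} {G' : etale_groupoid R d'}
    {G : etale_groupoid R d} (F : smooth_functor G' G) (c : pre_cech1 G) :
    pre_cech1 G' :=
  (c.1 \o far F, pullback (fob F) c.2).

(* The points of a partition of [0, 1] other than 0, in increasing order. *)
Record partition01 (R : realType) := Partition01 {
  ppts : seq R;
  ppts_sorted : path <%R 0 ppts;
  ppts_last : last 0 ppts = 1 }.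

Definition npieces {R} (W : partition01 R) : nat := size (ppts W).

Definition knot {R} (W : partition01 R) (i : nat) : R := nth 0 (0 :: ppts W) i.

Definition seg {R} (W : partition01 R) (i : nat) : set R :=
  `[knot W i, knot W i.+1].

(* Pieces are numbered from 0: [piece psi i] is a path on [seg (lpart psi) i]
   and [jump psi i] is the arrow at the right end point of this interval. Only
   these values, for [i < npieces (lpart psi)], are meaningful. *)
Record pre_loop {R d} (G : etale_groupoid R d) := PreLoop {
  lpart : partition01 R;
  piece : nat -> R -> ob G;
  jump : nat -> ar G }.

(* The piece following the [i]-th one, as a function near [knot W i.+1]. *)
Definition next_piece {R} {X : Type} (W : partition01 R) (p : nat -> R -> X)
    (i : nat) (t : R) : X :=
  if (i.+1 < npieces W)%N then p i.+1 t else p 0%N (t - 1).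

Section Loops.
Context {R : realType} {d : nat} (G : etale_groupoid R d).
Implicit Types psi phi : pre_loop G.

(* The germ at [gsrc g] of the local diffeomorphism [sigma] is the one defined
   by the arrow [g]. *)
Definition germ_of (g : ar G) (sigma : ob G -> ob G) : Prop :=
  \forall g' \near g, sigma (gsrc g') = gtgt g'.

Definition fits_smoothly (g : ar G) (a : R) (p q : R -> ob G) : Prop :=
  exists sigma, germ_of g sigma /\ exists2 e, 0 < e &
    smooth_into (`]a - e, a + e[ : set R)
      (fun t => if t <= a then sigma (p t) else q t).

Definition is_loop psi : Prop :=
  let W := lpart psi in
  forall i, (i < npieces W)%N ->
    [/\ smooth_into (seg W i) (piece psi i),
        gsrc (jump psi i) = piece psi i (knot W i.+1),
        gtgt (jump psi i) = next_piece W (piece psi) i (knot W i.+1) &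
        fits_smoothly (jump psi i) (knot W i.+1)
          (piece psi i) (next_piece W (piece psi) i)].

Definition same_loop psi phi : Prop :=
  lpart psi = lpart phi /\
  forall i, (i < npieces (lpart psi))%N ->
    {in seg (lpart psi) i, piece psi i =1 piece phi i} /\
    jump psi i = jump phi i.

(* [phi] is the image of [psi] under the inclusion inserting the point [b] in
   the interior of the [i]-th interval ([ppts_sorted (lpart phi)] forces [b]
   to lie there). *)
Definition insertion (i : nat) (b : R) psi phi : Prop :=
  let W := lpart psi in let W' := lpart phi in
  [/\ (i < npieces W)%N,
      ppts W' = take i (ppts W) ++ b :: drop i (ppts W) &
      forall j, (j < npieces W')%N ->
        {in seg W' j, piece phi j =1 piece psi (unbump i j)} /\
        jump phi j = if j == i then gid (piece psi i b)
                     else jump psi (unbump i j)].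

Definition is_arrow psi phi (L : nat -> R -> ar G) : Prop :=
  let W := lpart psi in
  lpart phi = W /\
  forall i, (i < npieces W)%N ->
    [/\ smooth_into (seg W i) (L i),
        {in seg W i, gsrc (e := G) \o L i =1 piece psi i},
        {in seg W i, gtgt (e := G) \o L i =1 piece phi i} &
        gcmp (L i (knot W i.+1)) (jump phi i) =
        gcmp (jump psi i) (next_piece W L i (knot W i.+1))].

Definition smooth_family (r : nat) (U : set 'rV[R]_r)
    (Psi : 'rV[R]_r -> pre_loop G) : Prop :=
  exists W : partition01 R,
    (forall u, U u -> is_loop (Psi u) /\ lpart (Psi u) = W) /\
    forall i, (i < npieces W)%N ->
      smooth_into (U `*` seg W i) (fun ut => piece (Psi ut.1) i ut.2) /\
      smooth_into U (fun u => jump (Psi u) i).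

(* A function on the colimit over all partitions is a function on the disjoint
   union of the sets of objects compatible with the inclusions. *)
Definition loop_cech0 : set (pre_loop G -> R[i]) :=
  [set H | [/\ (forall psi, is_loop psi -> H psi != 0),
     (forall psi phi, is_loop psi -> is_loop phi ->
        same_loop psi phi -> H psi = H phi),
     (forall i b psi phi, is_loop psi -> is_loop phi ->
        insertion i b psi phi -> H psi = H phi) &
     (forall r (U : set 'rV[R]_r) Psi, open U -> smooth_family U Psi ->
        csmooth_on U (H \o Psi))]].

Definition loop_cocycle0 : set (pre_loop G -> R[i]) :=
  [set H | loop_cech0 H /\
     forall psi phi L, is_loop psi -> is_loop phi -> is_arrow psi phi L ->
       H psi = H phi].

Definition holonomy (c : pre_cech1 G) psi : R[i] :=
  let W := lpart psi in
  cexp (\sum_(i < npieces W)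
          path_integral c.2 (knot W i) (knot W i.+1) (piece psi i)) *
  \prod_(i < npieces W) (c.1 (jump psi i))^-1.

End Loops.

Definition loop_map {R d' d} {G' : etale_groupoid R d'} {G : etale_groupoid R d}
    (F : smooth_functor G' G) (psi : pre_loop G') : pre_loop G :=
  PreLoop (lpart psi) (fun i => fob F \o piece psi i) (far F \o jump psi).

(* Main.v *)
(* The holonomy of a cochain (h, A) that is not a cocycle changes when a knot is
   inserted, by the value of h at a unit. So tau_1 is the holonomy of
   (h / h(e(s(-))), A): this is a homomorphism in (h, A), natural, equal to the
   holonomy on cocycles, and invariant under insertions by additivity of the
   integral. Smoothness along families is differentiation under the integral
   sign, to all orders, for integrands extending smoothly to the end points.

   If L is an arrow from psi to phi, pulling t^*A - s^*A = -dlog h back along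
   the path L_i and using exp(int dlog u) = u(b)/u(a) gives
     exp(int phi_i^*A) = exp(int psi_i^*A) h(L_i(a))/h(L_i(b)),
   while compatibility of L with the jumps and multiplicativity of h give
     h(phi(b))^-1 = h(psi(b))^-1 h(L_i(b))/h(L_{i+1}(b)),
   so that the factors telescope around the circle. The same telescoping gives
   holonomy 1 for coboundaries, hence the map on classes, computed on any
   representative. *)

Require Import Defs.
From HB Require Import structures.
From mathcomp Require Import all_boot all_order all_algebra.
From mathcomp Require Import complex.
From mathcomp Require Import all_classical all_reals all_analysis.
From mathcomp Require Import measurable_realfun ring.

Set Implicit Arguments.
Unset Strict Implicit.
Unset Printing Implicit Defensive.

Import Order.TTheory GRing.Theory Num.Theory.
Import numFieldNormedType.Exports.

Local Open Scope classical_set_scope.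
Local Open Scope ring_scope.
Local Open Scope complex_scope.

(** * Calculus of C^k maps *)

Section Ck.
Context {R : realType}.
Implicit Types V W : normedModType R.

(** Two features of the definitions shape the proof. A path is smooth on a closed interval in the
    sense that near each point it agrees there with a smooth map on an open set, while its velocity
    is a two-sided derivative and hence arbitrary at the end points. Integrands therefore need not
    be continuous on the closed interval. [cont_ext] and [smooth_ext] record that on the open
    interval they agree with functions that extend to the closed one, and integrals are compared
    through these extensions.

    Forms and smooth maps are given in charts. The quantity free of charts is [formval], the value
    of a form along a map; pullbacks, [dlog], changes of chart and path integrals are all reduced to
    it. *)

Lemma differentiable_eps {V W} (f : V -> W) (L : {linear V -> W}) x :
  continuous L ->
  (forall e, 0 < e -> \forall h \near 0, `|f (h + x) - f x - L h| <= e * `|h|) ->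
  differentiable f x /\ 'd f x = L :> (V -> W).
Proof.
move=> Lc H.
have E : f \o shift x = cst (f x) + L +o_ 0 id.
  apply/eqaddoP => e e0; near=> h.
  by rewrite /= [X in `|X|](_ : _ = f (h + x) - f x - L h) /= ?opprD ?addrA //; near: h; exact: H.
have dE := diff_unique Lc E.
by split=> //; apply/diff_locallyP; rewrite dE.
Unshelve. all: by end_near. Qed.

Lemma near_differentiable {V W} (f g : V -> W) x :
  (\forall y \near x, f y = g y) -> differentiable f x -> differentiable g x.
Proof.
move=> fg df.
have [] // := @differentiable_eps _ _ g ('d f x) x (@diff_continuous _ _ _ _ _ df).
move=> e e0.
have /eqaddoP /(_ e e0) := diff_locally df.
have : \forall h \near (0 : V), f (h + x) = g (h + x).
  have := near_shift 0 x (fun y => f y = g y); rewrite subr0 => E; rewrite E in fg; exact: fg.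
rewrite -(nbhs_singleton fg).
by apply: filterS2 => h <- /=; rewrite opprD addrA.
Qed.

Lemma near_derive {V W} (f g : V -> W) (x v : V) :
  (\forall y \near x, f y = g y) ->
  \forall y \near x, 'D_v f y = 'D_v g y.
Proof. by move=> /near_join; apply: filterS => y; exact: near_eq_derive. Qed.

Lemma derive_chain {V W W'} (f : V -> W) (g : W -> W') (x v : V) :
  differentiable f x -> differentiable g (f x) ->
  'D_v (fun y => g (f y)) x = 'D_('D_v f x) g (f x).
Proof.
move=> fd gd; rewrite deriveE; last exact: differentiable_comp.
by rewrite (@diff_comp _ _ _ _ f g) //= deriveE // deriveE.
Qed.

(** [differentiable] and ['D_v] at a point already look at a whole neighbourhood of it, so [Ck k U]
    is a condition on each point of [U] separately and may be tested on singletons. *)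
Lemma Ck_glue {V W} k (U : set V) (f : V -> W) :
  (forall x, U x -> Ck k [set x] f) -> Ck k U f.
Proof.
elim: k f => [|k IH] f H; first by move=> x Ux; exact: (H x Ux x erefl).
split=> [x Ux|v]; first exact: ((H x Ux).1 x erefl).
by apply: IH => x Ux; exact: (H x Ux).2.
Qed.

Lemma Ck_sub {V W} k (U U' : set V) (f : V -> W) :
  U' `<=` U -> Ck k U f -> Ck k U' f.
Proof.
move=> sU; elim: k f => [|k IH] f /= H; first by move=> x /sU; exact: H.
by split=> [x /sU|v]; [exact: H.1|exact/IH/H.2].
Qed.

Lemma Ck_near {V W} k x (f g : V -> W) :
  (\forall y \near x, f y = g y) -> Ck k [set x] f -> Ck k [set x] g.
Proof.
elim: k f g => [|k IH] f g fg /=.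
  move=> fc y ->; rewrite /prop_for /continuous_at -(nbhs_singleton fg).
  by apply: cvg_trans (fc x erefl); apply: near_eq_cvg; apply: filterS fg => ? ->.
move=> [fd fD]; split.
  by move=> y ->; exact: near_differentiable fg (fd x erefl).
by move=> v; apply: IH (fD v); exact: near_derive.
Qed.

Lemma eq_Ck {V W} k (U : set V) (f g : V -> W) :
  open U -> (forall x, U x -> f x = g x) -> Ck k U f -> Ck k U g.
Proof.
move=> Uo fg fk; apply: Ck_glue => x Ux; apply: (@Ck_near _ _ _ _ f).
  by have := open_nbhs_nbhs (conj Uo Ux); apply: filterS.
by apply: Ck_sub fk => _ ->.
Qed.

Lemma CkW {V W} k (U : set V) (f : V -> W) : Ck k.+1 U f -> Ck k U f.
Proof.
elim: k f => [|k IH] f [fd fD]; last by split=> // v; exact/IH/fD.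
by move=> x Ux; exact/differentiable_continuous/fd.
Qed.

Lemma Ck_cst {V W} k (U : set V) (w : W) : Ck k U (fun _ : V => w).
Proof.
elim: k w => [|k IH] w /=; first by move=> x _; exact: cvg_cst.
split=> [x _|v]; first exact: differentiable_cst.
suff -> : 'D_v (fun _ : V => w) = fun=> 0 by exact: IH.
by apply/funext => x; exact: derive_cst.
Qed.

Lemma CkD {V W} k (U : set V) (f g : V -> W) : open U ->
  Ck k U f -> Ck k U g -> Ck k U (fun x => f x + g x).
Proof.
move=> Uo; elim: k f g => [|k IH] f g /=.
  by move=> fc gc x Ux; apply: cvgD; [exact: fc|exact: gc].
move=> [fd fD] [gd gD]; split=> [x Ux|v].
  by apply: (@differentiableD _ _ _ f g); [exact: fd|exact: gd].
apply: (@eq_Ck _ _ _ _ (fun x => 'D_v f x + 'D_v g x) _ Uo) => [x Ux|].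
  by rewrite -deriveD //; apply: diff_derivable; [exact: fd|exact: gd].
exact: IH.
Qed.

Lemma Ck_sum {V W} k (U : set V) n (f : 'I_n -> V -> W) : open U ->
  (forall i, Ck k U (f i)) -> Ck k U (fun x => \sum_(i < n) f i x).
Proof.
move=> Uo; elim: n f => [|n IH] f H.
  by under eq_fun do rewrite big_ord0; exact: Ck_cst.
by under eq_fun do rewrite big_ord_recr; apply: CkD => //; exact: IH.
Qed.

Lemma deriveM_diff {V} (f g : V -> R^o) (x v : V) :
  differentiable f x -> differentiable g x ->
  'D_v (fun y => f y * g y : R^o) x = f x * 'D_v g x + g x * 'D_v f x.
Proof. by move=> fd gd; exact: deriveM (diff_derivable fd) (diff_derivable gd). Qed.

Lemma CkM {V} k (U : set V) (f g : V -> R^o) : open U ->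
  Ck k U f -> Ck k U g -> Ck k U (fun x => f x * g x : R^o).
Proof.
move=> Uo; elim: k f g => [|k IH] f g.
  by move=> fc gc x Ux; apply: cvgM; [exact: fc|exact: gc].
move=> Hf Hg; have [fd fD] := Hf; have [gd gD] := Hg; split=> [x Ux|v].
  by apply: (@differentiableM _ _ f g); [exact: fd|exact: gd].
apply: (@eq_Ck _ R^o _ _ (fun x => f x * 'D_v g x + g x * 'D_v f x) _ Uo) => [x Ux|].
  by rewrite deriveM_diff //; [exact: fd|exact: gd].
(* The Leibniz rule keeps [f] and [g] undifferentiated beside their derivatives, hence the recourse
   to [CkW]. *)
apply: (@CkD V R^o) => //; apply: IH.
- exact: (CkW Hf).
- exact: gD.
- exact: (CkW Hg).
- exact: fD.
Qed.

Lemma CkL {V W W'} k (U : set V) (f : V -> W) (L : {linear W -> W'}) :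
  open U -> continuous L -> Ck k U f -> Ck k U (fun x => L (f x)).
Proof.
move=> Uo Lc; elim: k f => [|k IH] f.
  by move=> fc x Ux; apply: continuous_comp; [exact: fc|exact: Lc].
move=> [fd fD]; split=> [x Ux|v].
  by apply: differentiable_comp; [exact: fd|exact: linear_differentiable].
apply: (@eq_Ck _ _ _ _ (fun x => L ('D_v f x)) _ Uo) => [x Ux|]; last exact: IH (fD v).
have Ld := @linear_differentiable _ _ _ L (f x) Lc.
by rewrite (derive_chain v (fd x Ux) Ld) (deriveE _ Ld) (diff_lin _ Lc).
Qed.

(** The chain rule gives ['D_('D_v f x) g (f x)], whose direction varies with [x], whereas [Ck]
    differentiates in fixed directions. The coordinates [l] on the middle space turn it into a
    finite sum over the fixed directions [e j], to which the induction applies. *)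
Lemma Ck_comp {V W W'} n (e : 'I_n -> W) (l : 'I_n -> {linear W -> R^o})
    k (U : set V) (U' : set W) (f : V -> W) (g : W -> R^o) :
  (forall j, continuous (l j)) -> (forall w, w = \sum_j l j w *: e j) ->
  open U -> (forall x, U x -> U' (f x)) ->
  Ck k U f -> Ck k U' g -> Ck k U (fun x => g (f x)).
Proof.
move=> lc le Uo fU; elim: k f g fU => [|k IH] f g fU.
  by move=> fc gc x Ux; apply: continuous_comp; [exact: fc|exact/gc/fU].
move=> Hf Hg; have [fd fD] := Hf; have [gd gD] := Hg; split=> [x Ux|v].
  by apply: differentiable_comp; [exact: fd|exact/gd/fU].
pose h x := \sum_j (l j ('D_v f x) * 'D_(e j) g (f x)).
apply: (@eq_Ck _ R^o _ _ h _ Uo) => [x Ux|].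
  have gdx := gd _ (fU _ Ux).
  rewrite (derive_chain v (fd x Ux) gdx) (deriveE _ gdx) [in RHS](le ('D_v f x)) linear_sum; apply: eq_bigr => j _.
  by rewrite linearZ (deriveE (e j) gdx).
apply: (@Ck_sum _ R^o) => // j; apply: CkM => //.
  by apply: CkL => //; exact: fD.
exact: (IH _ ('D_(e j) g) fU (CkW Hf) (gD _)).
Qed.

Lemma Ck_compR {V} k (U : set V) (U' : set R) (f : V -> R^o) (g : R^o -> R^o) :
  open U -> (forall x, U x -> U' (f x)) ->
  Ck k U f -> Ck k (U' : set R^o) g -> Ck k U (fun x => g (f x) : R^o).
Proof.
apply: (@Ck_comp V R^o R^o 1 (fun=> 1) (fun=> idfun)) => //.
  by move=> _ x; exact: cvg_id.
by move=> w; rewrite big_ord1 /= /GRing.scale /= mulr1.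
Qed.
(** Bundled as a linear map so that [CkL] and [Ck_comp] apply to coordinates. *)
Definition row_coord {n} (j : 'I_n) (w : 'rV[R]_n) : R^o := w 0 j.

Fact row_coord_linear n (j : 'I_n) : linear (@row_coord n j).
Proof. by move=> a u v; rewrite /row_coord !mxE. Qed.
HB.instance Definition _ n (j : 'I_n) :=
  GRing.isLinear.Build _ _ _ _ (@row_coord n j) (@row_coord_linear n j).

Lemma row_coord_continuous n (j : 'I_n) : continuous (@row_coord n j).
Proof. by move=> w; apply/differentiable_continuous/differentiable_coord. Qed.

Definition scale_by {W : normedModType R} (w : W) (a : R^o) : W := a *: w.

Fact scale_by_linear W (w : W) : linear (scale_by w).
Proof. by move=> a u v; rewrite /scale_by scalerDl scalerA. Qed.
HB.instance Definition _ W (w : W) :=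
  GRing.isLinear.Build _ _ _ _ (scale_by w) (@scale_by_linear W w).

Lemma scale_by_continuous W (w : W) : continuous (scale_by w).
Proof. by move=> a; apply: (@cvgZr_tmp R W R); exact: cvg_id. Qed.

Lemma Ck_row {V} n k (U : set V) (f : V -> 'rV[R]_n) : open U ->
  Ck k U f <-> forall j, Ck k U (fun x => f x 0 j : R^o).
Proof.
move=> Uo; split=> [fk j|fk].
  exact: (CkL (L := @row_coord n j) Uo (@row_coord_continuous n j) fk).
apply: (@eq_Ck _ _ _ _ (fun x => \sum_j scale_by (delta_mx 0 j : 'rV_n) (f x 0 j)) _ Uo).
  by move=> x _; rewrite [RHS]row_sum_delta.
apply: Ck_sum => // j.
exact: (CkL (L := scale_by (delta_mx 0 j : 'rV_n)) Uo (@scale_by_continuous _ _)).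
Qed.

Lemma Ck_comp_row {V} n k (U : set V) (U' : set 'rV[R]_n) (f : V -> 'rV[R]_n)
    (g : 'rV[R]_n -> R^o) :
  open U -> (forall x, U x -> U' (f x)) ->
  Ck k U f -> Ck k U' g -> Ck k U (fun x => g (f x)).
Proof.
apply: (@Ck_comp V 'rV[R]_n R^o n (delta_mx 0) (@row_coord n)).
  by move=> j; exact: row_coord_continuous.
by move=> w; rewrite [LHS]row_sum_delta.
Qed.

Lemma is_derive_real (f : R^o -> R^o) (x v df : R^o) :
  is_derive x 1 f df -> differentiable f x /\ 'D_v f x = v * df.
Proof.
move=> [/derivable1_diffP fd <-]; split=> //; rewrite !deriveE //.
by rewrite -{1}[v]mulr1 [LHS]linearZ.
Qed.

Lemma Ck_expR k : Ck k setT (expR : R^o -> R^o).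
Proof.
elim: k => [|k IH]; first by move=> x _; exact: continuous_expR.
split=> [x _|v]; first exact: (is_derive_real 0 (is_derive_expR x)).1.
have -> : 'D_v (expR : R^o -> R^o) = fun x => v * expR x.
  by apply/funext => x; exact: (is_derive_real v (is_derive_expR x)).2.
by apply: CkM => //; [exact: openT|exact: Ck_cst].
Qed.

Lemma Ck_trigo k : Ck k setT (cos : R^o -> R^o) /\ Ck k setT (sin : R^o -> R^o).
Proof.
elim: k => [|k [IHc IHs]].
  by split=> x _; [exact: continuous_cos|exact: continuous_sin].
split; (split; [move=> x _|move=> v]).
- exact: (is_derive_real 0 (is_derive_cos x)).1.
- have -> : 'D_v (cos : R^o -> R^o) = fun x => - v * sin x.
    apply/funext => x; rewrite (is_derive_real v (is_derive_cos x)).2.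
    by rewrite mulrN mulNr.
  by apply: CkM => //; [exact: openT|exact: Ck_cst].
- exact: (is_derive_real 0 (is_derive_sin x)).1.
- have -> : 'D_v (sin : R^o -> R^o) = fun x => v * cos x.
    by apply/funext => x; exact: (is_derive_real v (is_derive_sin x)).2.
  by apply: CkM => //; [exact: openT|exact: Ck_cst].
Qed.

Lemma Ck_inv k : Ck k [set x : R^o | x != 0] (GRing.inv : R^o -> R^o).
Proof.
have U0 : open [set x : R^o | x != 0] by exact: open_neq.
elim: k => [|k IH]; first by move=> x x0; exact/differentiable_continuous/differentiable_Rinv.
split=> [x x0|v]; first exact: differentiable_Rinv.
apply: (@eq_Ck R^o R^o _ _ (fun x => - v * (x^-1 * x^-1)) _ U0) => [x x0|].
  rewrite (deriveE v (differentiable_Rinv x0)) diff_Rinv // mulNr -mulrN.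
  by rewrite /GRing.scale /= mulrC expr2 invfM.
by apply: (CkM U0 (Ck_cst _ _ _)); exact: (CkM U0 IH IH).
Qed.
End Ck.

(** * Smooth complex-valued functions and smooth extensions *)

Section Smooth.
Context {R : realType}.
Implicit Types V W : normedModType R.

Lemma smooth_on_sub {V W} (U U' : set V) (f : V -> W) :
  U' `<=` U -> smooth_on U f -> smooth_on U' f.
Proof. by move=> sU fs k; exact: Ck_sub (fs k). Qed.

Lemma eq_smooth_on {V W} (U : set V) (f g : V -> W) :
  open U -> (forall x, U x -> f x = g x) -> smooth_on U f -> smooth_on U g.
Proof. by move=> Uo fg fs k; exact: eq_Ck (fs k). Qed.

Lemma smooth_on_glue {V W} (U : set V) (f : V -> W) :
  (forall x, U x -> exists N, [/\ open N, N x & smooth_on N f]) -> smooth_on U f.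
Proof.
move=> H k; apply: Ck_glue => x /H[N [_ Nx fs]].
by apply: Ck_sub (fs k) => _ ->.
Qed.

Lemma smooth_on_derive {V W} (U : set V) (f : V -> W) v :
  smooth_on U f -> smooth_on U ('D_v f).
Proof. by move=> fs k; exact: (fs k.+1).2. Qed.

Lemma smooth_on_diff {V W} (U : set V) (f : V -> W) x :
  smooth_on U f -> U x -> differentiable f x.
Proof. by move=> fs; exact: (fs 1%N).1. Qed.

Lemma smooth_on_continuous {V W} (U : set V) (f : V -> W) x :
  smooth_on U f -> U x -> {for x, continuous f}.
Proof. by move=> fs; exact: (fs 0%N). Qed.

Lemma smooth_on_id {n} (U : set 'rV[R]_n) : open U -> smooth_on U id.
Proof.
move=> Uo [|k]; first by move=> x _; exact: cvg_id.
split=> [x _|v]; first exact: ex_diff.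
suff -> : 'D_v (@id 'rV[R]_n) = fun=> v by exact: Ck_cst.
by apply/funext => x; exact: derive_id.
Qed.

Lemma smooth_on_comp_row {V} n m (U : set V) (U' : set 'rV[R]_n)
    (f : V -> 'rV[R]_n) (g : 'rV[R]_n -> 'rV[R]_m) :
  open U -> open U' -> (forall x, U x -> U' (f x)) ->
  smooth_on U f -> smooth_on U' g -> smooth_on U (g \o f).
Proof.
move=> Uo U'o fU fs gs k; apply/Ck_row => // j.
exact: (Ck_comp_row (g := fun w => g w 0 j) Uo fU (fs k) ((Ck_row _ _ U'o).1 (gs k) j)).
Qed.

Lemma eq_csmooth_on {V} (U : set V) (f g : V -> R[i]) :
  open U -> (forall x, U x -> f x = g x) -> csmooth_on U f -> csmooth_on U g.
Proof.
by move=> Uo fg [fr fi]; split; [move: fr|move: fi]; apply: eq_smooth_on => // x /fg ->.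
Qed.

Lemma csmooth_on_cst {V} (U : set V) (z : R[i]) : csmooth_on U (fun=> z).
Proof. by split=> k; exact: Ck_cst. Qed.

Lemma csmooth_onD {V} (U : set V) (f g : V -> R[i]) : open U ->
  csmooth_on U f -> csmooth_on U g -> csmooth_on U (fun x => f x + g x).
Proof.
move=> Uo [fr fi] [gr gi].
split=> k.
  apply: (@eq_Ck _ V R^o _ _ _ _ Uo _ (CkD Uo (fr k) (gr k))) => x _.
  by case: (f x) (g x) => [? ?] [? ?].
apply: (@eq_Ck _ V R^o _ _ _ _ Uo _ (CkD Uo (fi k) (gi k))) => x _.
by case: (f x) (g x) => [? ?] [? ?].
Qed.

Lemma csmooth_onM {V} (U : set V) (f g : V -> R[i]) : open U ->
  csmooth_on U f -> csmooth_on U g -> csmooth_on U (fun x => f x * g x).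
Proof.
move=> Uo [fr fi] [gr gi].
have CkN k (h : V -> R^o) : Ck k U h -> Ck k U (fun x => -1 * h x : R^o).
  by move=> hk; apply: CkM => //; exact: Ck_cst.
split=> k.
  apply: (@eq_Ck _ V R^o _ _ _ _ Uo _ (CkD Uo (CkM Uo (fr k) (gr k))
    (CkN _ _ (CkM Uo (fi k) (gi k))))) => x _.
  by rewrite mulN1r; case: (f x) (g x) => [? ?] [? ?].
apply: (@eq_Ck _ V R^o _ _ _ _ Uo _ (CkD Uo (CkM Uo (fr k) (gi k))
    (CkM Uo (fi k) (gr k)))) => x _.
by case: (f x) (g x) => [? ?] [? ?].
Qed.

Lemma csmooth_onV {V} (U : set V) (f : V -> R[i]) : open U ->
  (forall x, U x -> f x != 0) ->
  csmooth_on U f -> csmooth_on U (fun x => (f x)^-1).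
Proof.
move=> Uo f0 [fr fi].
(* [q] is the squared modulus: the inverse of [f] is its conjugate divided by [q]. *)
pose q x : R^o := complex.Re (f x) * complex.Re (f x) + complex.Im (f x) * complex.Im (f x).
have q0 x : U x -> q x != 0.
  move=> /f0; rewrite /q; case: (f x) => [a b] /=; apply: contraNneq.
  move/eqP; rewrite -!expr2 paddr_eq0 ?sqr_ge0 // !sqrf_eq0 => /andP[/eqP-> /eqP->].
  by rewrite eqxx.
have qk k : Ck k U q by apply: (CkD Uo (CkM Uo (fr k) (fr k)) (CkM Uo (fi k) (fi k))).
have qV k := Ck_compR Uo q0 (qk k) (Ck_inv k).
have fN k := CkM Uo (Ck_cst k U (-1 : R^o)) (fi k).
split=> k.
  apply: (@eq_Ck _ V R^o _ _ _ _ Uo _ (CkM Uo (fr k) (qV k))) => x _.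
  by rewrite /q; case: (f x) => [a b] /=.
apply: (@eq_Ck _ V R^o _ _ _ _ Uo _ (CkM Uo (fN k) (qV k))) => x _.
by rewrite /q; case: (f x) => [a b] /=; rewrite mulN1r mulNr.
Qed.

Lemma csmooth_on_exp {V} (U : set V) (f : V -> R[i]) : open U ->
  csmooth_on U f -> csmooth_on U (fun x => cexp (f x)).
Proof.
move=> Uo [fr fi].
have ek k := Ck_compR Uo (fun _ _ => I) (fr k) (Ck_expR k).
have ck k := Ck_compR Uo (fun _ _ => I) (fi k) (Ck_trigo k).1.
have sk k := Ck_compR Uo (fun _ _ => I) (fi k) (Ck_trigo k).2.
by split=> k; [exact: CkM (ek k) (ck k)|exact: CkM (ek k) (sk k)].
Qed.

Lemma csmooth_on_sum {V} (U : set V) n (f : 'I_n -> V -> R[i]) : open U ->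
  (forall i, csmooth_on U (f i)) -> csmooth_on U (fun x => \sum_(i < n) f i x).
Proof.
move=> Uo; elim: n f => [|n IH] f H.
  by under eq_fun do rewrite big_ord0; exact: csmooth_on_cst.
by under eq_fun do rewrite big_ord_recr; apply: csmooth_onD => //; exact: IH.
Qed.

Lemma csmooth_on_prod {V} (U : set V) n (f : 'I_n -> V -> R[i]) : open U ->
  (forall i, csmooth_on U (f i)) -> csmooth_on U (fun x => \prod_(i < n) f i x).
Proof.
move=> Uo; elim: n f => [|n IH] f H.
  by under eq_fun do rewrite big_ord0; exact: csmooth_on_cst.
by under eq_fun do rewrite big_ord_recr; apply: csmooth_onM => //; exact: IH.
Qed.

Lemma csmooth_on_comp_row {V} n (U : set V) (U' : set 'rV[R]_n)
    (f : V -> 'rV[R]_n) (g : 'rV[R]_n -> R[i]) :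
  open U -> (forall x, U x -> U' (f x)) ->
  smooth_on U f -> csmooth_on U' g -> csmooth_on U (g \o f).
Proof.
move=> Uo fU fs [gr gi]; split=> k; last exact: Ck_comp_row (fs k) (gi k).
exact: Ck_comp_row (fs k) (gr k).
Qed.

Lemma csmooth_on_derive {V} (U : set V) (f : V -> R[i]) v :
  csmooth_on U f -> csmooth_on U (fun x => cderive f x v).
Proof. by move=> [fr fi]; split; [exact: smooth_on_derive fr|exact: smooth_on_derive fi]. Qed.

(* Used with [T] open inside [S]: on a closed interval a derivative is only
   meaningful in the interior, but it extends smoothly to the end points. *)
Definition smooth_ext {V W} (T S : set V) (f : V -> W) : Prop :=
  forall x, S x -> exists N (g : V -> W),
    [/\ open N, N x, smooth_on N g & forall y, N y -> T y -> f y = g y].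

Definition csmooth_ext {V} (T S : set V) (f : V -> R[i]) : Prop :=
  smooth_ext T S (fun x => complex.Re (f x) : R^o) /\
  smooth_ext T S (fun x => complex.Im (f x) : R^o).

Lemma csmooth_extP {V} (T S : set V) (f : V -> R[i]) :
  (forall x, S x -> exists N g,
    [/\ open N, N x, csmooth_on N g & forall y, N y -> T y -> f y = g y]) ->
  csmooth_ext T S f.
Proof.
move=> H; split=> x /H[N [g [No Nx [gr gi] fg]]].
  by exists N, (fun y => complex.Re (g y)); split=> // y Ny Ty; rewrite fg.
by exists N, (fun y => complex.Im (g y)); split=> // y Ny Ty; rewrite fg.
Qed.

Lemma csmooth_ext_open {V} (U : set V) (f : V -> R[i]) : open U ->
  csmooth_ext U U f -> csmooth_on U f.
Proof.
move=> Uo [fr fi]; split; apply: smooth_on_glue => x Ux.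
  have [N [g [No Nx gs fg]]] := fr x Ux; exists (N `&` U); split=> //.
    exact: openI.
  apply: (@eq_smooth_on _ R^o _ g); first exact: openI.
    by move=> y [Ny Uy]; rewrite fg.
  by apply: smooth_on_sub gs => y [].
have [N [g [No Nx gs fg]]] := fi x Ux; exists (N `&` U); split=> //.
  exact: openI.
apply: (@eq_smooth_on _ R^o _ g); first exact: openI.
  by move=> y [Ny Uy]; rewrite fg.
by apply: smooth_on_sub gs => y [].
Qed.
End Smooth.

(** * Integrals of functions smooth up to the end points *)

Section Integral.
Context {R : realType}.
Implicit Types (a b : R) (w : R -> R).

Local Notation mu := (@lebesgue_measure R).

(* The values of [w] at [a] and [b] are junk: [w] will be a derivative along a
   path that is only smooth on [`[a, b]]. *)
Definition cont_ext a b w : Prop :=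
  exists2 v : R -> R, {within `[a, b], continuous v} & {in `]a, b[, w =1 v}.

(** In the interior [w] inherits continuity from the local functions [g]; new values are needed at
    the two end points alone, and come from the [g] found there. *)
Lemma cont_extP a b w : a < b ->
  (forall t, t \in `[a, b] -> exists2 g : R -> R, {for t, continuous g} &
     \forall s \near t, s \in `]a, b[ -> w s = g s) ->
  cont_ext a b w.
Proof.
move=> ab H.
have aab : a \in `[a, b] by rewrite in_itv /= lexx ltW.
have bab : b \in `[a, b] by rewrite in_itv /= lexx ltW.
have [ga gac ga_eq] := H a aab.
have [gb gbc gb_eq] := H b bab.
pose v t := if t == a then ga a else if t == b then gb b else w t.
have wv : {in `]a, b[, w =1 v}.
  by move=> t; rewrite in_itv /= /v => /andP[at_ tb]; rewrite gt_eqF // lt_eqF.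
exists v => //; apply/continuous_within_itvP => //; split.
- move=> t tab; have [g gc gw] := H t (subset_itv_oo_cc tab).
  have gE : \forall s \near t, g s = v s.
    have : \forall s \near t, s \in `]a, b[ by apply: near_in_itvoo.
    by apply: filterS2 gw => s /[swap] sab /(_ sab) <-; rewrite -wv.
  rewrite /continuous_at -(nbhs_singleton gE).
  by apply: cvg_trans gc; apply: near_eq_cvg.
- rewrite {2}/v eqxx; apply: cvg_trans (cvg_at_right_filter gac); apply: near_eq_cvg.
  near=> s.
  have sab : s \in `]a, b[.
    by rewrite in_itv /=; apply/andP; split; near: s; [exact: nbhs_right_gt|exact: nbhs_right_lt].
  by rewrite -wv //; apply/esym; move: sab; near: s; exact: cvg_within ga_eq.
- rewrite {2}/v eqxx gt_eqF //; apply: cvg_trans (cvg_at_left_filter gbc); apply: near_eq_cvg.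
  near=> s.
  have sab : s \in `]a, b[.
    by rewrite in_itv /=; apply/andP; split; near: s; [exact: nbhs_left_gt|exact: nbhs_left_lt].
  by rewrite -wv //; apply/esym; move: sab; near: s; exact: cvg_within gb_eq.
Unshelve. all: by end_near. Qed.

Lemma smooth_ext_cont_ext a b (w : R -> R^o) : a < b ->
  smooth_ext (`]a, b[ : set R) (`[a, b] : set R) w -> cont_ext a b w.
Proof.
move=> ab H; apply: cont_extP => // t tab.
have [N [g [No Nt gs wg]]] := H t tab.
exists g; first exact: smooth_on_continuous gs Nt.
by have := open_nbhs_nbhs (conj No Nt); apply: filterS => s Ns; exact: wg.
Qed.

Definition itv_integral a b w : R := \int[mu]_(t in `[a, b]) w t.

Lemma cont_ext_measurable a b w : cont_ext a b w -> measurable_fun (`]a, b[ : set R) w.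
Proof.
move=> [v vc wv]; have [ab|ba] := ltP a b; last first.
  by rewrite set_itv_ge ?bnd_simp -?leNgt //; exact: measurable_fun_set0.
apply: (@eq_measurable_fun _ _ _ _ _ v); first by move=> t; rewrite inE /= => /wv.
apply: open_continuous_measurable_fun; first exact: interval_open.
have [vi _ _] := (continuous_within_itvP v ab).1 vc.
by move=> t; rewrite inE /=; exact: vi.
Qed.

(** The end points form a null set; [cont_ext] supplies the measurability needed to discard them. *)
Lemma eq_itv_integral a b w v : cont_ext a b w -> cont_ext a b v ->
  {in `]a, b[, w =1 v} -> itv_integral a b w = itv_integral a b v.
Proof.
move=> wc vc wv; rewrite /itv_integral /Rintegral; congr fine.
by apply: eq_integral_itv_bounded; [exact: cont_ext_measurable|exact: cont_ext_measurable|].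
Qed.

Lemma within_cont_ext a b w : {within `[a, b], continuous w} -> cont_ext a b w.
Proof. by move=> wc; exists w. Qed.

Lemma within_integrable a b w : {within `[a, b], continuous w} ->
  mu.-integrable `[a, b] (EFin \o w).
Proof. by apply: continuous_compact_integrable; exact: segment_compact. Qed.

Lemma cont_ext_eq a b w v : {in `]a, b[, w =1 v} -> cont_ext a b w -> cont_ext a b v.
Proof. by move=> wv [u uc wu]; exists u => // t tab; rewrite -wv // wu. Qed.

Lemma cont_extD a b w v : cont_ext a b w -> cont_ext a b v ->
  cont_ext a b (fun t => w t + v t) /\
  itv_integral a b (fun t => w t + v t) = itv_integral a b w + itv_integral a b v.
Proof.
move=> wc vc; have [w' w'c ww'] := wc; have [v' v'c vv'] := vc.
have sc : {within `[a, b], continuous (fun t => w' t + v' t)}.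
  by move=> t; apply: cvgD; [exact: w'c|exact: v'c].
have cs : cont_ext a b (fun t => w t + v t).
  by exists (fun t => w' t + v' t) => // t tab; rewrite ww' // vv'.
split=> //.
rewrite (eq_itv_integral wc (within_cont_ext w'c)) // (eq_itv_integral vc (within_cont_ext v'c)) //.
rewrite (eq_itv_integral cs (within_cont_ext sc)).
  by rewrite /itv_integral RintegralD //; exact: within_integrable.
by move=> t tab; rewrite ww' // vv'.
Qed.

Lemma cont_extZ a b k w : cont_ext a b w ->
  cont_ext a b (fun t => k * w t) /\
  itv_integral a b (fun t => k * w t) = k * itv_integral a b w.
Proof.
move=> wc; have [w' w'c ww'] := wc.
have sc : {within `[a, b], continuous (fun t => k * w' t)}.
  by move=> t; apply: cvgM; [exact: cvg_cst|exact: w'c].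
have cs : cont_ext a b (fun t => k * w t).
  by exists (fun t => k * w' t) => // t tab; rewrite ww'.
split=> //.
rewrite (eq_itv_integral wc (within_cont_ext w'c)) // (eq_itv_integral cs (within_cont_ext sc)).
  by rewrite /itv_integral RintegralZl //; exact: within_integrable.
by move=> t tab; rewrite ww'.
Qed.

Lemma cont_ext_sum a b n (w : 'I_n -> R -> R) : (forall j, cont_ext a b (w j)) ->
  cont_ext a b (fun t => \sum_j w j t) /\
  itv_integral a b (fun t => \sum_j w j t) = \sum_j itv_integral a b (w j).
Proof.
elim: n w => [|n IH] w H.
  have E : (fun t => \sum_(j < 0) w j t) = fun=> 0.
    by apply/funext => t; rewrite big_ord0.
  rewrite E; split; first by apply: within_cont_ext => t; exact: cvg_cst.
  by rewrite big_ord0 /itv_integral Rintegral_cst // mul0r.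
have E : (fun t => \sum_(j < n.+1) w j t) =
    fun t => \sum_(j < n) w (widen_ord (leqnSn n) j) t + w ord_max t.
  by apply/funext => t; rewrite big_ord_recr.
have [c1 e1] := IH (fun j => w (widen_ord (leqnSn n) j)) (fun j => H _).
have [c2 e2] := cont_extD c1 (H ord_max).
by rewrite E; split=> //; rewrite e2 e1 big_ord_recr.
Qed.

Lemma itv_integral_le a b w C : a < b -> cont_ext a b w ->
  (forall t, t \in `]a, b[ -> `|w t| <= C) -> `|itv_integral a b w| <= C * (b - a).
Proof.
move=> ab wc wC.
have [w' w'c ww'] := wc.
have wi := within_integrable w'c.
have wi1 : mu.-integrable `[a, b[ (EFin \o w').
  by apply: integrableS wi => //; exact: subset_itv_co_cc.
have wi2 : mu.-integrable `]a, b[ (EFin \o w').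
  by apply: integrableS wi => //; exact: subset_itv_oo_cc.
rewrite (eq_itv_integral wc (within_cont_ext w'c)) // /itv_integral.
(* The bound is known in the interior only, so the integral is first moved to the open interval. *)
rewrite -Rintegral_itv_bndo_bndc // -Rintegral_itv_obnd_cbnd //.
apply: (le_trans (le_normr_Rintegral _ wi2)) => //.
have Ci : mu.-integrable `]a, b[ (EFin \o (fun=> C)).
  have : mu.-integrable `[a, b] (EFin \o (fun=> C)).
    by apply: (@within_integrable a b (fun=> C)) => t; exact: cvg_cst.
  by apply: integrableS => //; exact: subset_itv_oo_cc.
have ni : mu.-integrable `]a, b[ (EFin \o (fun t => `|w' t|)) by exact: integrable_norm.
apply: (le_trans (le_Rintegral _ ni Ci _)) => //.
  by move=> t tab; rewrite -ww' //; exact: wC.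
rewrite Rintegral_cst //= lebesgue_measure_itv /= lte_fin ab.
by rewrite -EFinB.
Qed.

Lemma continuous_pair_l {X Y : topologicalType} (y : Y) (x : X) :
  {for x, continuous (fun s : X => (s, y))}.
Proof.
exact: (@cvg_pair _ _ _ (nbhs x) (nbhs x) (nbhs y) _ _ _ id (fun=> y) (@cvg_id _ _) (cvg_cst _)).
Qed.

Lemma continuous_pair_r {X Y : topologicalType} (x : X) (y : Y) :
  {for y, continuous (fun s : Y => (x, s))}.
Proof.
exact: (@cvg_pair _ _ _ (nbhs y) (nbhs x) (nbhs y) _ _ _ (fun=> x) id (cvg_cst _) (@cvg_id _ _)).
Qed.

(** * Differentiation under the integral sign *)

Section IntegralParam.
Context {r : nat} (a b : R) (ab : a < b).
Implicit Types (U : set 'rV[R]_r).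

Definition param_ext U (w : 'rV[R]_r -> R -> R) := smooth_ext (U `*` (`]a, b[ : set R)) (U `*` (`[a, b] : set R))
  (fun z : 'rV[R]_r * R => w z.1 z.2 : R^o).

Lemma param_ext_cont U (w : 'rV[R]_r -> R -> R) u : U u -> param_ext U w -> cont_ext a b (w u).
Proof.
move=> Uu H; apply: cont_extP => // t tab.
have [N [g [No Nt gs wg]]] := H (u, t) (conj Uu tab).
have pc : {for t, continuous (fun s : R => (u, s))}.
  exact: continuous_pair_r.
exists (fun s => g (u, s)).
  exact: (continuous_comp pc (smooth_on_continuous gs Nt)).
have : \forall s \near t, N (u, s) by apply: pc; exact: (open_nbhs_nbhs (conj No Nt)).
by apply: filterS => s Ns sab; exact: (wg _ Ns (conj Uu sab)).
Qed.

Lemma derive_fst (g : 'rV[R]_r * R -> R^o) (v : 'rV[R]_r) u t :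
  'D_((v, 0) : 'rV[R]_r * R) g (u, t) = 'D_v (fun u => g (u, t)) u.
Proof.
rewrite /derive.
suff E : (fun h : R => h^-1 *: ((g \o shift (u, t)) (h *: ((v, 0) : 'rV[R]_r * R)) - g (u, t))) =
         (fun h : R => h^-1 *: (((fun u => g (u, t)) \o shift u) (h *: v) - g (u, t))).
  by rewrite E.
apply/funext => h /=.
have -> : h *: ((v, 0) : 'rV[R]_r * R) + (u, t) = (h *: v + u, t).
  by congr pair; rewrite /= scaler0 add0r.
by [].
Qed.

Lemma is_derive_line (g : 'rV[R]_r * R -> R^o) (h u : 'rV[R]_r) (s t : R) :
  derivable g (s *: h + u, t) ((h, 0) : 'rV[R]_r * R) ->
  is_derive s (1 : R) (fun s => g (s *: h + u, t) : R)
    ('D_((h, 0) : 'rV[R]_r * R) g (s *: h + u, t)).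
Proof.
have E : (fun k : R => k^-1 *: ((g \o shift (s *: h + u, t)) (k *: ((h, 0) : 'rV[R]_r * R)) -
      g (s *: h + u, t))) =
    (fun k : R => k^-1 *: (((fun s => g (s *: h + u, t)) \o shift s) (k *: (1 : R)) -
      g (s *: h + u, t))).
  apply/funext => k /=.
  have -> // : k *: ((h, 0) : 'rV[R]_r * R) + (s *: h + u, t) = ((k *: 1 + s) *: h + u, t).
  congr pair; rewrite /= ?scaler0 ?add0r //.
  by rewrite scalerDl addrA /GRing.scale /= mulr1.
by rewrite /derivable /derive E => gd; split.
Qed.

(** A derivative in the parameter stays in the slice of fixed [t], so a local extension [g] of [w]
    yields the local extension ['D_((v, 0)) g] of the derivative. The hypothesis thus reproduces
    itself at every order. *)
Lemma param_ext_derive U (w : 'rV[R]_r -> R -> R) v : open U -> param_ext U w ->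
  param_ext U (fun u t => 'D_v (fun u => w u t : R^o) u).
Proof.
move=> Uo H [u t] [/= Uu tab]; have [N [g [No Nt gs wg]]] := H (u, t) (conj Uu tab).
exists N, ('D_((v, 0) : 'rV[R]_r * R) g); split=> //; first exact: smooth_on_derive.
move=> [u' t'] Nz [/= Uu' tab']; rewrite derive_fst; apply: near_eq_derive.
have pc : {for u', continuous (fun s : 'rV[R]_r => (s, t'))}.
  exact: continuous_pair_l.
have nN : \forall s \near u', N (s, t').
  by apply: pc; exact: (open_nbhs_nbhs (conj No Nz)).
have := open_nbhs_nbhs (conj Uo Uu').
by apply: filterS2 nN => s Ns Us; exact: (wg _ Ns (conj Us tab')).
Qed.

Lemma norm_row_coord_le (h : 'rV[R]_r) j : `|h 0 j| <= `|h|.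
Proof.
rewrite [leRHS]/Num.Def.normr /= mx_normrE.
by apply/bigmax_geP; right; exists (0, j).
Qed.

Lemma sum_row_le (h : 'rV[R]_r) (c : 'I_r -> R) e : 0 <= e ->
  (forall j, `|c j| <= e) -> `|\sum_j h 0 j * c j| <= r%:R * e * `|h|.
Proof.
move=> e0 ce; apply: (le_trans (ler_norm_sum _ _ _)).
apply: (@le_trans _ _ (\sum_(j < r) e * `|h|)).
  apply: ler_sum => j _; rewrite normrM mulrC.
  by apply: ler_pM => //; exact: norm_row_coord_le.
by rewrite sumr_const card_ord -[leLHS]mulr_natl mulrA.
Qed.

(* Mean value estimate along [s *: h + u0]; its uniformity in [t] near [t0] is
   what the compactness of [`[a, b]] turns into differentiability of the integral. *)
Lemma param_local U (w : 'rV[R]_r -> R -> R) u0 t0 e : open U -> U u0 -> t0 \in `[a, b] -> 0 < e ->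
  param_ext U w ->
  \forall t \near t0 & h \near (0 : 'rV[R]_r), t \in `]a, b[ ->
    `|w (h + u0) t - w u0 t -
      \sum_j h 0 j * 'D_(delta_mx 0 j) (fun u => w u t : R^o) u0| <= e * `|h|.
Proof.
move=> Uo Uu0 t0ab e0 H; have [N [g [No Nz gs wg]]] := H (u0, t0) (conj Uu0 t0ab).
pose dg j := 'D_((delta_mx 0 j, 0) : 'rV[R]_r * R) g.
(* The mean value theorem leaves [r] terms, each comparing a partial derivative at two points that
   are both within [eta] of its value at [(u0, t0)]. The total is at most [r * (2 * eta) * |h|], and
   [r.+1] in place of [r] keeps the denominator nonzero when [r] is 0. *)
pose eta := e / (2 * (r.+1)%:R).
have eta0 : 0 < eta by rewrite divr_gt0 // mulr_gt0.
have : \forall z \near (u0, t0), N z /\ U z.1 /\ forall j, `|dg j (u0, t0) - dg j z| <= eta.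
  have n1 := open_nbhs_nbhs (conj No Nz).
  have n2 : \forall z \near (u0, t0), U z.1.
    exact: (cvg_fst (open_nbhs_nbhs (conj Uo Uu0))).
  have n3 : \forall z \near (u0, t0), forall j, `|dg j (u0, t0) - dg j z| <= eta.
    have ff := @filter_forall _ _ (fun j z => `|dg j (u0, t0) - dg j z| <= eta) (nbhs (u0, t0)) _.
    apply: ff => j.
    have /cvgrPdist_le /(_ _ eta0) := smooth_on_continuous (smooth_on_derive (delta_mx 0 j, 0) gs) Nz.
    by [].
  by near=> z; split; [near: z|split; near: z].
move=> /nbhs_ballP[d /= d0 dP].
exists ((ball t0 d : set R), (ball 0 d : set 'rV[R]_r)).
  by split; exact: nbhsx_ballx.
move=> [t h] [/= bt bh] tab.
have segP s : s \in `[0, 1] -> N (s *: h + u0, t) /\ U (s *: h + u0) /\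
    forall j, `|dg j (u0, t0) - dg j (s *: h + u0, t)| <= eta.
  rewrite in_itv /= => /andP[s0 s1].
  apply: (dP (s *: h + u0, t)); split => //=.
  move: bh; rewrite -!ball_normE /ball_ /= opprD addrCA subrr addr0 sub0r !normrN normrZ ger0_norm //.
  by apply: le_lt_trans; rewrite ler_piMl.
have [N0 [_ dg0]] : N (0 *: h + u0, t) /\ U (0 *: h + u0) /\
    forall j, `|dg j (u0, t0) - dg j (0 *: h + u0, t)| <= eta.
  by apply: segP; rewrite in_itv /= lexx ler01.
rewrite scale0r add0r in N0 dg0.
have [N1 [U1 _]] : N (1 *: h + u0, t) /\ U (1 *: h + u0) /\
    forall j, `|dg j (u0, t0) - dg j (1 *: h + u0, t)| <= eta.
  by apply: segP; rewrite in_itv /= lexx ler01.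
rewrite scale1r in N1 U1.
have -> : w (h + u0) t = g (h + u0, t) by exact: (wg _ N1 (conj U1 tab)).
have -> : w u0 t = g (u0, t) by exact: (wg _ N0 (conj Uu0 tab)).
have -> : \sum_j h 0 j * 'D_(delta_mx 0 j) (fun u => w u t : R^o) u0 =
          \sum_j h 0 j * dg j (u0, t).
  apply: eq_bigr => j _; congr (_ * _); rewrite /dg derive_fst; apply: near_eq_derive.
  have pc : {for u0, continuous (fun s : 'rV[R]_r => (s, t))}.
    exact: continuous_pair_l.
  have nN : \forall s \near u0, N (s, t).
    by apply: pc; exact: (open_nbhs_nbhs (conj No N0)).
  have := open_nbhs_nbhs (conj Uo Uu0).
  by apply: filterS2 nN => s Ns Us; exact: (wg _ Ns (conj Us tab)).
pose phi s : R := g (s *: h + u0, t).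
pose dphi s : R := \sum_j h 0 j * dg j (s *: h + u0, t).
have phiD (s : R) : s \in `[0, 1] -> is_derive s (1 : R) phi (dphi s).
  move=> s01; have [Ns _] := segP s s01.
  have gd := smooth_on_diff gs Ns.
  rewrite /dphi; under eq_bigr do rewrite /dg deriveE //.
  have <- : 'D_((h, 0) : 'rV[R]_r * R) g (s *: h + u0, t) =
      \sum_j h 0 j * 'd g (s *: h + u0, t) ((delta_mx 0 j, 0) : 'rV[R]_r * R).
    rewrite deriveE //.
    have -> : ((h, 0) : 'rV[R]_r * R) = \sum_j h 0 j *: ((delta_mx 0 j, 0) : 'rV[R]_r * R).
      rewrite {1}(row_sum_delta h); elim/big_rec2: _ => // j _ y _ <-.
      by congr pair; rewrite /= scaler0 add0r.
    by rewrite linear_sum; apply: eq_bigr => j _; rewrite linearZ.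
  exact: is_derive_line (diff_derivable gd).
have phic : {within `[0, 1], continuous phi}.
  by apply: derivable_within_continuous => s /phiD[].
have [c c01] := MVT_segment (@ler01 R) (fun s s01 => phiD s (subset_itv_oo_cc s01)) phic.
rewrite /phi scale1r scale0r add0r subr0 mulr1 => ->.
rewrite /dphi -sumrB; under eq_bigr do rewrite -mulrBr.
have eta20 : 0 <= 2 * eta by rewrite mulr_ge0 // ltW.
apply: (le_trans (@sum_row_le _ _ (2 * eta) eta20 _)).
  move=> j; have [_ [_ /(_ j) dgc]] := segP c c01.
  rewrite -(subrKA (dg j (u0, t0))) mulr_natl mulr2n.
  by apply: (le_trans (ler_normD _ _)); rewrite lerD // distrC.
have -> : 2 * eta = e / r.+1%:R by rewrite /eta invfM mulrCA mulVKf ?pnatr_eq0.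
by rewrite ler_wpM2r // mulrCA ler_piMr ?ltW // ltr_pdivrMr ?mul1r ?ltr_nat.
Unshelve. all: by end_near. Qed.

Lemma param_integral_diff U (w : 'rV[R]_r -> R -> R) u0 : open U -> U u0 ->
  param_ext U w ->
  let F u : R^o := itv_integral a b (w u) in
  let c j := itv_integral a b (fun t => 'D_(delta_mx 0 j) (fun u => w u t : R^o) u0) in
  differentiable F u0 /\ forall h, 'D_h F u0 = \sum_j h 0 j * c j.
Proof.
move=> Uo Uu0 H F c.
pose L : 'rV[R]_r -> R^o := fun h => \sum_j h 0 j * c j.
have Ll : linear L.
  move=> k x y; rewrite /L scaler_sumr -big_split; apply: eq_bigr => j _.
  by rewrite !mxE mulrDl /GRing.scale /= mulrA.
pose LL := HB.pack_for {linear 'rV[R]_r -> R^o} L (GRing.isLinear.Build _ _ _ _ L Ll).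
have Lc : continuous LL.
  have L0 : Ck 0 setT L.
    apply: (@Ck_sum R 'rV[R]_r R^o 0 setT r (fun j h => h 0 j * c j) openT) => j.
    by apply: (CkM openT _ (Ck_cst _ _ _)) => x _; exact: row_coord_continuous.
  by move=> x; exact: L0.
have := @differentiable_eps _ _ _ F LL u0 Lc.
have Fe : forall e : R, 0 < e -> \forall h \near (0 : 'rV[R]_r),
    `|F (h + u0) - F u0 - LL h| <= e * `|h|.
  move=> e e0.
  have ba : 0 < b - a by rewrite subr_gt0.
  (* Integration multiplies the pointwise bound by the length of the interval. *)
  pose e' := e / (b - a).
  have e'0 : 0 < e' by rewrite divr_gt0.
  have /compact_near_coveringP/(_ _ (nbhs (0 : 'rV[R]_r))) cov := @segment_compact R a b.
  have covh := cov (fun h t => t \in `]a, b[ ->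
    `|w (h + u0) t - w u0 t -
      \sum_j h 0 j * 'D_(delta_mx 0 j) (fun u => w u t : R^o) u0| <= e' * `|h|) (nbhs_filter _)
    (fun t tab => param_local Uo Uu0 tab e'0 H).
  have nU : \forall h \near (0 : 'rV[R]_r), U (h + u0).
    have := near_shift 0 u0 U; rewrite subr0 => <-.
    exact: (open_nbhs_nbhs (conj Uo Uu0)).
  near=> h.
  have Uh : U (h + u0) by near: h.
  have hP := near covh h.
  have cd j := param_ext_cont Uu0 (param_ext_derive (delta_mx 0 j) Uo H).
  have [cs es] := cont_ext_sum (fun j => (cont_extZ (h 0 j) (cd j)).1).
  have [cN eN] := cont_extZ (-1) cs.
  have [c0N e0N] := cont_extZ (-1) (param_ext_cont Uu0 H).
  have [c1 e1] := cont_extD (param_ext_cont Uh H) c0N.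
  have [c2 e2] := cont_extD c1 cN.
  have -> : F (h + u0) - F u0 - LL h = itv_integral a b (fun t =>
      w (h + u0) t + -1 * w u0 t +
      -1 * (\sum_j h 0 j * 'D_(delta_mx 0 j) (fun u => w u t : R^o) u0)).
    rewrite e2 e1 eN e0N es !mulN1r; congr (_ - _).
    by apply: eq_bigr => j _; rewrite (cont_extZ (h 0 j) (cd j)).2.
  have -> : e * `|h| = (e' * `|h|) * (b - a) by rewrite mulrAC /e' divfK // gt_eqF.
  apply: itv_integral_le => // t tab.
  by rewrite !mulN1r; apply: hP => //; exact: subset_itv_oo_cc.
move=> /(_ Fe)[Fd Fdd]; split=> // h.
by rewrite deriveE // Fdd.
Unshelve. all: by end_near. Qed.

(** The derivatives of the integral are finite sums of integrals whose integrands again satisfy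
    [param_ext]; hence an induction on the order, over all [w]. *)
Lemma param_integral_smooth U (w : 'rV[R]_r -> R -> R) : open U ->
  param_ext U w -> smooth_on U (fun u => itv_integral a b (w u) : R^o).
Proof.
move=> Uo H k; elim: k w H => [|k IH] w H.
  by move=> u Uu; apply/differentiable_continuous; have [] := param_integral_diff Uo Uu H.
split=> [u Uu|v]; first by have [] := param_integral_diff Uo Uu H.
pose F u := \sum_j v 0 j *
  itv_integral a b (fun t => 'D_(delta_mx 0 j) (fun u => w u t : R^o) u).
apply: (@eq_Ck _ _ R^o _ _ F _ Uo) => [u Uu|].
  by have [_ ->] := param_integral_diff Uo Uu H.
apply: (@Ck_sum _ _ R^o) => // j; apply: (CkM Uo (Ck_cst _ _ _)).
by apply: IH; exact: param_ext_derive.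
Qed.
End IntegralParam.
End Integral.

(** * The complex exponential and integrals of logarithmic derivatives *)

Section Exponential.
Context {R : realType}.
Implicit Types z w : R[i].

Lemma eq_complex_parts z w :
  complex.Re z = complex.Re w -> complex.Im z = complex.Im w -> z = w.
Proof. by case: z w => [a b] [c d] /= -> ->. Qed.

Lemma cexpD z w : cexp (z + w) = cexp z * cexp w.
Proof.
case: z w => [a b] [c d]; apply: eq_complex_parts => /=; rewrite /= expRD ?cosD ?sinD; ring.
Qed.

Lemma cexp0 : cexp 0 = 1 :> R[i].
Proof. by rewrite /cexp /= expR0 cos0 sin0 mulr1 mulr0. Qed.

Lemma cexpN z : cexp (- z) * cexp z = 1.
Proof. by rewrite -cexpD addNr cexp0. Qed.

Lemma cexp_neq0 z : cexp z != 0.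
Proof.
apply/eqP => z0; have := cexpN z; rewrite z0 mulr0 => /eqP.
by rewrite eq_sym oner_eq0.
Qed.

Lemma cexp_sum n (f : 'I_n -> R[i]) :
  cexp (\sum_(i < n) f i) = \prod_(i < n) cexp (f i).
Proof.
elim: n f => [|n IH] f; first by rewrite !big_ord0 cexp0.
by rewrite !big_ord_recr /= cexpD IH.
Qed.

Lemma is_derive_cst_itv (a b : R) (f : R -> R) : a < b ->
  {within `[a, b], continuous f} ->
  (forall t, t \in `]a, b[ -> is_derive t (1 : R) f 0) -> f b = f a.
Proof.
move=> ab fc fd; have [c _] := MVT_segment (ltW ab) fd fc.
by rewrite mul0r => /eqP; rewrite subr_eq0 => /eqP.
Qed.

(** The fundamental theorem is applied to the continuous extension [v], which has the same integral
    as [f] and agrees with it wherever the derivative is taken. *)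
Lemma primitive (a b : R) (f : R -> R) : a < b -> cont_ext a b f ->
  exists P : R -> R, [/\ {within `[a, b], continuous P}, P a = 0,
    P b = itv_integral a b f & forall t, t \in `]a, b[ -> is_derive t (1 : R) P (f t)].
Proof.
move=> ab fc; have [v vc fv] := fc.
have vi := within_integrable vc.
exists (fun x => itv_integral a x v); split.
- exact: (parameterized_integral_continuous (ltW ab) vi).
- by rewrite /itv_integral set_itv1 Rintegral_set1.
- by rewrite (eq_itv_integral fc (within_cont_ext vc)).
- move=> t tab; have [vin _ _] := (continuous_within_itvP v ab).1 vc.
  move: (tab); rewrite in_itv /= => /andP[at_ tb].
  have [] // := continuous_FTC1_closed tb vi at_ (vin t tab).
  by move=> Pd; rewrite derive1E fv // => <-; exact: DeriveDef.
Qed.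

(** No branch of the logarithm is chosen. If [P + iQ] is a primitive of [f = u'/u], then exp(-(P +
    iQ)) u has derivative exp(-(P + iQ)) (u' - f u) = 0; [X] and [Y] below are its real and
    imaginary parts, so both are constant. *)
Lemma cexp_integral_dlog (a b : R) (u f : R -> R[i]) : a < b ->
  {within `[a, b], continuous (fun t => complex.Re (u t))} ->
  {within `[a, b], continuous (fun t => complex.Im (u t))} ->
  (forall t, t \in `[a, b] -> u t != 0) ->
  (forall t, t \in `]a, b[ -> derivable (fun t => complex.Re (u t) : R^o) t (1 : R) /\
     derivable (fun t => complex.Im (u t) : R^o) t (1 : R)) ->
  (forall t, t \in `]a, b[ -> f t = (u t)^-1 * cderive u t (1 : R)) ->
  cont_ext a b (fun t => complex.Re (f t)) ->
  cont_ext a b (fun t => complex.Im (f t)) ->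
  cexp (cintegral a b f) = u b * (u a)^-1.
Proof.
move=> ab urc uic u0 ud fE frc fic.
have [P [Pc Pa Pb Pd]] := primitive ab frc.
have [Q [Qc Qa Qb Qd]] := primitive ab fic.
pose ur t := complex.Re (u t); pose ui t := complex.Im (u t).
pose X t := expR (- P t) * (cos (Q t) * ur t + sin (Q t) * ui t).
pose Y t := expR (- P t) * (cos (Q t) * ui t - sin (Q t) * ur t).
have wc (g h : R -> R) : continuous g -> {within `[a, b], continuous h} ->
    {within `[a, b], continuous (fun t => g (h t))}.
  by move=> gc hc t; exact: (cvg_comp _ _ (hc t) (gc _)).
have NPc : {within `[a, b], continuous (fun t => - P t)} by move=> t; apply: cvgN; exact: Pc.
have Ec := wc _ _ (@continuous_expR R) NPc.
have Cc := wc _ _ (@continuous_cos R) Qc.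
have Sc := wc _ _ (@continuous_sin R) Qc.
have Xc : {within `[a, b], continuous X}.
  move=> t; apply: cvgM; first exact: Ec.
  by apply: cvgD; apply: cvgM; [exact: Cc|exact: urc|exact: Sc|exact: uic].
have Yc : {within `[a, b], continuous Y}.
  move=> t; apply: cvgM; first exact: Ec.
  by apply: cvgB; apply: cvgM; [exact: Cc|exact: uic|exact: Sc|exact: urc].
have key t : t \in `]a, b[ -> is_derive t (1 : R) X 0 /\ is_derive t (1 : R) Y 0.
  move=> tab; have [/derivableP dr /derivableP di] := ud t tab.
  have [dP dQ] := (Pd t tab, Qd t tab).
  have iM (g h : R -> R) dg dh : is_derive t (1 : R) g dg -> is_derive t (1 : R) h dh ->
      is_derive t (1 : R) (fun t => g t * h t) (g t * dh + h t * dg).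
    by move=> ? ?; exact: is_deriveM.
  have iD (g h : R -> R) dg dh : is_derive t (1 : R) g dg -> is_derive t (1 : R) h dh ->
      is_derive t (1 : R) (fun t => g t + h t) (dg + dh).
    by move=> ? ?; exact: is_deriveD.
  have iB (g h : R -> R) dg dh : is_derive t (1 : R) g dg -> is_derive t (1 : R) h dh ->
      is_derive t (1 : R) (fun t => g t - h t) (dg - dh).
    by move=> ? ?; exact: is_deriveB.
  have dN : is_derive t (1 : R) (fun t => - P t) (- complex.Re (f t)) by exact: is_deriveN.
  have dE : is_derive t (1 : R) (fun t => expR (- P t)) (expR (- P t) * - complex.Re (f t)).
    exact: (@is_derive1_comp _ expR (fun t => - P t)).
  have dC : is_derive t (1 : R) (fun t => cos (Q t)) (- sin (Q t) * complex.Im (f t)).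
    exact: (@is_derive1_comp _ cos Q).
  have dS : is_derive t (1 : R) (fun t => sin (Q t)) (cos (Q t) * complex.Im (f t)).
    exact: (@is_derive1_comp _ sin Q).
  (* The equation u' = u f, split into real and imaginary parts, is what cancels the derivatives of
     [X] and [Y]. *)
  have uf : cderive u t 1 = u t * f t.
    by rewrite fE // mulrA divff ?mul1r // u0 //; exact: subset_itv_oo_cc.
  have [er ei] : 'D_1 (fun t => complex.Re (u t) : R^o) t =
        ur t * complex.Re (f t) - ui t * complex.Im (f t) /\
      'D_1 (fun t => complex.Im (u t) : R^o) t =
        ur t * complex.Im (f t) + ui t * complex.Re (f t).
    by move: uf; rewrite /cderive /ur /ui; case: (u t) (f t) => [? ?] [? ?] [].
  rewrite er in dr; rewrite ei in di.
  split.
    apply: (is_derive_eq (iM _ _ _ _ dE (iD _ _ _ _ (iM _ _ _ _ dC dr) (iM _ _ _ _ dS di)))).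
    by rewrite /= /ur /ui; ring.
  apply: (is_derive_eq (iM _ _ _ _ dE (iB _ _ _ _ (iM _ _ _ _ dC di) (iM _ _ _ _ dS dr)))).
  by rewrite /= /ur /ui; ring.
have XE : X b = X a by apply: is_derive_cst_itv => // t /key[].
have YE : Y b = Y a by apply: is_derive_cst_itv => // t /key[].
have E : cexp (- cintegral a b f) * u b = u a.
  rewrite /cintegral -/(itv_integral a b _) -/(itv_integral a b _) -Pb -Qb.
  move: XE YE; rewrite /X /Y Pa Qa oppr0 expR0 cos0 sin0 !mul1r !mul0r addr0 subr0 /ur /ui.
  case: (u a) (u b) => [? ?] [? ?] /= <- <-.
  by apply: eq_complex_parts; rewrite /= cosN sinN; ring.
rewrite -E invfM mulrCA mulfV ?mulr1; last by rewrite u0 // in_itv /= lexx ltW.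
by apply: (mulfI (cexp_neq0 (- cintegral a b f))); rewrite cexpN mulfV // cexp_neq0.
Qed.
End Exponential.

(** * Charts, smooth maps and 1-forms *)

(** Used to shrink the domain [N] of a local extension [g] to the part that [g] sends into the
    domain of the next map. *)
Lemma open_preimage_on {X Y : topologicalType} (N : set X) (I : set Y) (g : X -> Y) :
  open N -> open I -> (forall x, N x -> {for x, continuous g}) ->
  open (N `&` g @^-1` I).
Proof.
move=> No Io gc; rewrite openE => y [Ny gy]; rewrite /interior.
have : \forall z \near y, I (g z).
  by apply: (gc _ Ny); exact: (open_nbhs_nbhs (conj Io gy)).
by apply: filterS2 (open_nbhs_nbhs (conj No Ny)) => z.
Qed.

Section Charts.
Context {R : realType} {d : nat} {M : smooth_space R d} (Mm : is_manifold M).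
Implicit Types c : chart R d M.

Lemma chart_atP (x : M) : atlas (chart_at x) /\ cdom (chart_at x) x.
Proof.
rewrite /chart_at; case: pselect => [e|ne]; first by case: (cid e).
by have [_ _ _ /(_ x)[c ca cx] _] := Mm; case: ne; exists c.
Qed.

Lemma cmapK c x : atlas c -> cdom c x -> cinv c (cmap c x) = x.
Proof. by have [_ _ /(_ c) H _ _] := Mm => /H[_ _ + _ _]; apply. Qed.

Lemma cimg_cdom c y : atlas c -> cimg c y -> cdom c (cinv c y).
Proof. by move=> ca [x xc <-]; rewrite cmapK. Qed.

Lemma cinvK c y : atlas c -> cimg c y -> cmap c (cinv c y) = y.
Proof. by move=> ca [x xc <-]; rewrite cmapK. Qed.

Lemma open_cdom c : atlas c -> open (cdom c).
Proof. by have [_ _ /(_ c) H _ _] := Mm => /H[]. Qed.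

Lemma open_cimg c : atlas c -> open (cimg c).
Proof. by have [_ _ /(_ c) H _ _] := Mm => /H[]. Qed.

Lemma cinv_continuous c y : atlas c -> cimg c y -> {for y, continuous (cinv c)}.
Proof.
move=> ca yc; have [_ _ /(_ c ca) [_ _ _ _ H] _ _] := Mm.
move: H; rewrite continuous_open_subspace; last exact: open_cimg.
by apply; rewrite inE.
Qed.

Lemma open_cmap_image c (N : set M) : atlas c -> open N ->
  open (cmap c @` (cdom c `&` N)).
Proof.
move=> ca No; have Io := open_cimg ca.
rewrite openE => y [x [xc xO] <-].
have yc : cimg c (cmap c x) by exists x.
have : \forall z \near cmap c x, N (cinv c z).
  by apply: (cinv_continuous ca yc); rewrite cmapK //; exact: open_nbhs_nbhs.
have := open_nbhs_nbhs (conj Io yc).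
rewrite /interior; apply: filterS2 => z zc zO.
by exists (cinv c z); [split=> //; exact: cimg_cdom|exact: cinvK].
Qed.

Lemma transition_smooth c c' : atlas c -> atlas c' ->
  smooth_on (cmap c @` (cdom c `&` cdom c')) (cmap c' \o cinv c).
Proof. by move=> ca ca'; have [_ _ _ _] := Mm; apply. Qed.

Lemma transition_diff c c' x : atlas c -> atlas c' -> cdom c x -> cdom c' x ->
  differentiable (cmap c' \o cinv c) (cmap c x).
Proof.
move=> ca ca' xc xc'; apply: (smooth_on_diff (transition_smooth ca ca')).
by exists x.
Qed.

End Charts.

Section Differentiability.
Context {R : realType} {d : nat} {M : smooth_space R d} (Mm : is_manifold M).
Implicit Types (c : chart R d M) (V W : normedModType R).

(** One chart is enough: staying in its domain near [y], together with differentiability, makes [p]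
    continuous at [y], and smooth transition maps then carry the property to every chart around
    [p y]. *)
Definition diff_at {V} (p : V -> M) (y : V) : Prop :=
  exists c, [/\ atlas c, \forall y' \near y, cdom c (p y') &
    differentiable (cmap c \o p) y].

Lemma diff_at_continuous {V} (p : V -> M) y : diff_at p y -> {for y, continuous p}.
Proof.
move=> [c [ca pc pd]].
have E : \forall y' \near y, (cinv c \o (cmap c \o p)) y' = p y'.
  by apply: filterS pc => y' pc'; rewrite /= (cmapK Mm).
have yc : cimg c (cmap c (p y)) by exists (p y) => //; exact: nbhs_singleton pc.
have C : {for y, continuous (cinv c \o (cmap c \o p))}.
  apply: continuous_comp; first exact: differentiable_continuous.
  exact: (cinv_continuous Mm).
rewrite /prop_for /continuous_at -(nbhs_singleton E).
by apply: cvg_trans C; apply: near_eq_cvg.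
Qed.

Lemma diff_at_chart {V} (p : V -> M) y c : diff_at p y -> atlas c -> cdom c (p y) ->
  (\forall y' \near y, cdom c (p y')) /\ differentiable (cmap c \o p) y.
Proof.
move=> pd ca yc.
have pc : \forall y' \near y, cdom c (p y').
  apply: (diff_at_continuous pd).
  exact: (open_nbhs_nbhs (conj (open_cdom Mm ca) yc)).
split=> //; have [c0 [c0a p0 p0d]] := pd.
apply: (@near_differentiable _ _ _ ((cmap c \o cinv c0) \o (cmap c0 \o p))).
  by apply: filterS p0 => y' y'0; rewrite /= (cmapK Mm).
apply: differentiable_comp => //.
by apply: (transition_diff Mm) => //; exact: nbhs_singleton p0.
Qed.

Lemma derive_chart {V} (p : V -> M) y v c c' : diff_at p y ->
  atlas c -> cdom c (p y) -> atlas c' -> cdom c' (p y) ->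
  'D_v (cmap c' \o p) y = 'D_('D_v (cmap c \o p) y) (cmap c' \o cinv c) (cmap c (p y)).
Proof.
move=> pd ca yc ca' yc'; have [pc pcd] := diff_at_chart pd ca yc.
rewrite -(derive_chain v pcd (transition_diff Mm ca ca' yc yc')).
by apply: near_eq_derive; apply: filterS pc => y' y'c; rewrite /= (cmapK Mm).
Qed.

Lemma smooth_into_diff_at {V} (S : set V) (p : V -> M) y :
  smooth_into S p -> nbhs y S -> diff_at p y.
Proof.
move=> ps yS; have [c [N [g [ca [No Ny] gs pg]]]] := ps y (nbhs_singleton yS).
have nN := open_nbhs_nbhs (conj No Ny).
exists c; split=> //; first by apply: filterS2 yS nN => z zS zO; have [] := pg z zS zO.
apply: (near_differentiable _ (smooth_on_diff gs Ny)).
by apply: filterS2 yS nN => z zS zO; have [_ /= ->] := pg z zS zO.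
Qed.

Lemma diff_at_cinv c y : atlas c -> cimg c y -> diff_at (cinv c) y.
Proof.
move=> ca yc; have nc := open_nbhs_nbhs (conj (open_cimg Mm ca) yc).
exists c; split=> //; first by apply: filterS nc => z; exact: (cimg_cdom Mm).
apply: (@near_differentiable _ _ _ id); last exact: ex_diff.
by apply: filterS nc => z zc; rewrite /= (cinvK Mm).
Qed.

Lemma smooth_into_cinv c : atlas c -> smooth_into (cimg c) (cinv c).
Proof.
move=> ca y yc; exists c, (cimg c), id; split=> //.
- by split=> //; exact: (open_cimg Mm).
- exact/smooth_on_id/(open_cimg Mm).
- by move=> z zc _; split; [exact: (cimg_cdom Mm)|exact: (cinvK Mm)].
Qed.

Lemma smooth_into_sub {V} (S S' : set V) (p : V -> M) :
  S' `<=` S -> smooth_into S p -> smooth_into S' p.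
Proof.
move=> sS ps x /sS /ps[c [N [g [ca Nx gs pg]]]]; exists c, N, g; split=> //.
by move=> y /sS; exact: pg.
Qed.

Lemma smooth_into_chart {V} (S : set V) (p : V -> M) x c :
  smooth_into S p -> S x -> atlas c -> cdom c (p x) -> 
  exists N (g : V -> 'rV[R]_d), [/\ open N /\ N x, smooth_on N g &
    forall y, S y -> N y -> cdom c (p y) /\ cmap c (p y) = g y].
Proof.
move=> ps Sx ca xc; have [c0 [N [g [c0a [No Nx] gs pg]]]] := ps x Sx.
(* Off [S] nothing confines [g] to the image of [c0], so its domain is cut down to where the
   transition map to [c] is defined. *)
pose I := cmap c0 @` (cdom c0 `&` cdom c).
have Io : open I by apply: (open_cmap_image Mm) => //; exact: (open_cdom Mm).
have [x0 gx] := pg x Sx Nx.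
have NIo : open (N `&` g @^-1` I).
  by apply: open_preimage_on => // y; exact: smooth_on_continuous gs.
exists (N `&` g @^-1` I), ((cmap c \o cinv c0) \o g); split.
- by split=> //; split=> //; exists (p x).
- apply: (@smooth_on_comp_row _ _ _ _ _ I).
  + exact: NIo.
  + exact: Io.
  + by move=> y [].
  + by apply: smooth_on_sub gs => y [].
  + exact: (transition_smooth Mm).
- move=> y Sy [Ny [z [z0 zc] zg]].
  have [y0 gy] := pg y Sy Ny.
  have <- : z = p y by rewrite -(cmapK Mm c0a z0) zg -gy (cmapK Mm).
  by rewrite /= -zg (cmapK Mm).
Qed.
End Differentiability.

Section SmoothMaps.
Context {R : realType} {d e : nat} {M : smooth_space R d} {N : smooth_space R e}.
Context (Mm : is_manifold M) (Nm : is_manifold N).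
Implicit Types (V : normedModType R) (f : M -> N).

Lemma smooth_map_chart f c c' x : smooth_map f -> atlas c -> atlas c' ->
  cdom c x -> cdom c' (f x) -> exists2 I : set 'rV[R]_d, open I /\ I (cmap c x) &
  [/\ smooth_on I (cmap c' \o f \o cinv c), I `<=` cimg c &
      forall z, cdom c z -> I (cmap c z) -> cdom c' (f z)].
Proof.
move=> [fc fs] ca ca' xc xc'.
pose I := cmap c @` (setT `&` cdom c `&` f @^-1` cdom c').
exists I; first split; last 2 first.
- by exists x.
- split; first exact: fs.
  + by move=> y [z [[_ zc] _] <-]; exists z.
  + move=> z zc [w [[_ wc] wc'] wz].
    by rewrite -(cmapK Mm ca zc) -wz (cmapK Mm ca wc).
rewrite /I (_ : _ `&` _ = cdom c `&` f @^-1` cdom c'); last by rewrite setTI.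
apply: (open_cmap_image Mm) => //.
apply: open_comp; last exact: (open_cdom Nm).
by move=> y _; exact: fc.
Qed.

Lemma smooth_map_into {V} f (S : set V) (p : V -> M) :
  smooth_map f -> smooth_into S p -> smooth_into S (f \o p).
Proof.
move=> fs ps x Sx.
have [ca xc] := chart_atP Mm (p x); have [ca' xc'] := chart_atP Nm (f (p x)).
have [I [Io Ix] [Is Ic If]] := smooth_map_chart fs ca ca' xc xc'.
have [K [g [[Ko Kx] gs pg]]] := smooth_into_chart Mm ps Sx ca xc.
have KIo : open (K `&` g @^-1` I).
  by apply: open_preimage_on => // y; exact: smooth_on_continuous gs.
exists (chart_at (f (p x))), (K `&` g @^-1` I),
  ((cmap (chart_at (f (p x))) \o f \o cinv (chart_at (p x))) \o g).
split=> //.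
- by split=> //; split=> //=; have [_ <-] := pg x Sx Kx.
- apply: (@smooth_on_comp_row _ _ _ _ _ I) => //.
  + by move=> y [].
  + by apply: smooth_on_sub gs => y [].
- move=> y Sy [Ky /= Iy]; have [yc gy] := pg y Sy Ky; rewrite -gy in Iy *.
  by split; [exact: If|rewrite (cmapK Mm)].
Qed.

Lemma smooth_map_diff_at {V} f (p : V -> M) y :
  smooth_map f -> diff_at p y -> diff_at (f \o p) y.
Proof.
move=> fs pd.
have [ca yc] := chart_atP Mm (p y); have [ca' yc'] := chart_atP Nm (f (p y)).
have [I [Io Iy] [Is Ic If]] := smooth_map_chart fs ca ca' yc yc'.
have [pc pcd] := diff_at_chart Mm pd ca yc.
have nI := differentiable_continuous pcd (open_nbhs_nbhs (conj Io Iy)).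
exists (chart_at (f (p y))); split=> //.
  by apply: filterS2 pc nI => z zc zI; exact: If.
apply: (@near_differentiable _ _ _ ((cmap (chart_at (f (p y))) \o f \o
  cinv (chart_at (p y))) \o (cmap (chart_at (p y)) \o p))).
  by apply: filterS pc => z zc; rewrite /= (cmapK Mm).
by apply: differentiable_comp => //; exact: (smooth_on_diff Is).
Qed.

Lemma csmooth_into {V} (h : M -> R[i]) (S : set V) (p : V -> M) :
  csmooth h -> smooth_into S p -> csmooth_ext S S (h \o p).
Proof.
move=> hs ps; apply: csmooth_extP => x Sx.
have [c [K [g [ca [Ko Kx] gs pg]]]] := ps x Sx.
have KIo : open (K `&` g @^-1` cimg c).
  apply: open_preimage_on => //; first exact: (open_cimg Mm).
  by move=> y; exact: smooth_on_continuous gs.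
have [xc gx] := pg x Sx Kx.
exists (K `&` g @^-1` cimg c), ((h \o cinv c) \o g); split=> //.
- by split=> //=; rewrite -gx; exists (p x).
- apply: (@csmooth_on_comp_row _ _ _ _ (cimg c)) => //.
  + by move=> y [].
  + by apply: smooth_on_sub gs => y [].
  + exact: hs.
- move=> y [Ky _] Sy; have [yc gy] := pg y Sy Ky.
  by rewrite /= -gy (cmapK Mm).
Qed.

Lemma csmooth_diff (h : M -> R[i]) c x : csmooth h -> atlas c -> cdom c x ->
  differentiable (fun y => complex.Re (h (cinv c y)) : R^o) (cmap c x) /\
  differentiable (fun y => complex.Im (h (cinv c y)) : R^o) (cmap c x).
Proof.
move=> hs ca xc; have [hr hi] := hs c ca.
have xi : cimg c (cmap c x) by exists x.
by split; [exact: (smooth_on_diff hr)|exact: (smooth_on_diff hi)].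
Qed.

Lemma csmooth_diff_at {V} (h : M -> R[i]) (p : V -> M) y : csmooth h -> diff_at p y ->
  differentiable (fun y => complex.Re (h (p y)) : R^o) y /\
  differentiable (fun y => complex.Im (h (p y)) : R^o) y.
Proof.
move=> hs [c [ca pc pd]]; have [hr hi] := csmooth_diff hs ca (nbhs_singleton pc).
split.
  have := differentiable_comp pd hr; apply: near_differentiable.
  by apply: filterS pc => z zc; rewrite /= (cmapK Mm).
have := differentiable_comp pd hi; apply: near_differentiable.
by apply: filterS pc => z zc; rewrite /= (cmapK Mm).
Qed.

End SmoothMaps.

Lemma csmooth_comp {R : realType} {d e} {M : smooth_space R d} {N : smooth_space R e}
    (h : N -> R[i]) (f : M -> N) : is_manifold M -> is_manifold N ->
  csmooth h -> smooth_map f -> csmooth (h \o f).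
Proof.
move=> Mm Nm hs fs c ca; apply: csmooth_ext_open; first exact: (open_cimg Mm).
apply: (csmooth_into Nm hs).
by apply: (smooth_map_into Mm Nm fs); exact: (smooth_into_cinv Mm).
Qed.

Lemma local_diffeo_smooth {R : realType} {d e} {M : smooth_space R d}
    {N : smooth_space R e} (f : M -> N) : local_diffeo f -> smooth_map f.
Proof.
move=> fl; split=> [x _|c c' ca ca'].
  by have [U [g [[Uo Ux] _ [fc _] _ _]]] := fl x; exact: fc.
move=> k; apply: Ck_glue => _ [x [[_ xc] xc'] <-].
have [U [g [[Uo Ux] _ [_ fs] _ _]]] := fl x.
by apply: Ck_sub (fs c c' ca ca' k) => _ ->; exists x.
Qed.

Section Pairing.
Context {R : realType} {d : nat}.
Implicit Types (a : 'rV[R[i]]_d) (v : 'rV[R]_d).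

Lemma pairingDl a b v : pairing (a + b) v = pairing a v + pairing b v.
Proof. by rewrite -big_split; apply: eq_bigr => j _; rewrite !mxE mulrDl. Qed.

Lemma pairingNl a v : pairing (- a) v = - pairing a v.
Proof. by rewrite -sumrN; apply: eq_bigr => j _; rewrite !mxE mulNr. Qed.

Lemma pairing0l v : pairing 0 v = 0 :> R[i].
Proof. by rewrite /pairing big1 // => j _; rewrite !mxE mul0r. Qed.

Lemma pairing_sum a n (k : 'I_n -> R) (v : 'I_n -> 'rV[R]_d) :
  pairing a (\sum_i k i *: v i) = \sum_i pairing a (v i) * (k i)%:C.
Proof.
rewrite /pairing; under [RHS]eq_bigr do rewrite mulr_suml.
rewrite exchange_big; apply: eq_bigr => j _.
rewrite summxE rmorph_sum mulr_sumr; apply: eq_bigr => i _.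
by rewrite !mxE rmorphM mulrAC -mulrA.
Qed.
End Pairing.

Section Chain.
Context {R : realType}.
Implicit Types V : normedModType R.

(** The row is the covector [a] pulled back by the differential of [f] at [y]. Both [pullback] and
    the change of charts in [is_form1] produce components of this shape. *)
Lemma pairing_derive {n e} (a : 'rV[R[i]]_e) (f : 'rV[R]_n -> 'rV[R]_e) y v :
  differentiable f y ->
  pairing (\row_j pairing a ('D_(delta_mx 0 j) f y)) v = pairing a ('D_v f y).
Proof.
move=> fd; rewrite [in RHS](row_sum_delta v) deriveE // linear_sum.
under [in RHS]eq_bigr do rewrite linearZ.
rewrite pairing_sum; apply: eq_bigr => j _.
by rewrite mxE deriveE.
Qed.

Lemma derive_row_sum {n} (g : 'rV[R]_n -> R^o) y (w : 'rV[R]_n) : differentiable g y ->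
  'D_w g y = \sum_j w 0 j * 'D_(delta_mx 0 j) g y.
Proof.
move=> gd; rewrite deriveE // [in LHS](row_sum_delta w) linear_sum.
by apply: eq_bigr => j _; rewrite linearZ deriveE.
Qed.

Lemma cderive_chain {V} {n} (h : 'rV[R]_n -> R[i]) (f : V -> 'rV[R]_n) y v :
  differentiable (fun z => complex.Re (h z) : R^o) (f y) ->
  differentiable (fun z => complex.Im (h z) : R^o) (f y) ->
  differentiable f y ->
  cderive (h \o f) y v =
    pairing (\row_j cderive h (f y) (delta_mx 0 j)) ('D_v f y).
Proof.
move=> hr hi fd; rewrite /cderive (derive_chain v fd hr) (derive_chain v fd hi).
rewrite (derive_row_sum _ hr) (derive_row_sum _ hi); apply: eq_complex_parts.
  rewrite /pairing (raddf_sum (@complex.Re R)); apply: eq_bigr => j _.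
  by rewrite mxE /cderive /= mulr0 subr0 mulrC.
rewrite /pairing (raddf_sum (@complex.Im R)); apply: eq_bigr => j _.
by rewrite mxE /cderive /= mulr0 add0r mulrC.
Qed.

Lemma near_cderive {V} (f g : V -> R[i]) y v :
  (\forall z \near y, f z = g z) -> cderive f y v = cderive g y v.
Proof.
move=> fg; rewrite /cderive; congr (_ +i* _).
  by apply: near_eq_derive; apply: filterS fg => z ->.
by apply: near_eq_derive; apply: filterS fg => z ->.
Qed.

Lemma csmooth_on_pairing {V} n (U : set V) (a : V -> 'rV[R[i]]_n) (w : V -> 'rV[R]_n) :
  open U -> (forall j, csmooth_on U (fun x => a x 0 j)) -> smooth_on U w ->
  csmooth_on U (fun x => pairing (a x) (w x)).
Proof.
move=> Uo as_ ws; apply: csmooth_on_sum => // j; apply: csmooth_onM => //.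
by split=> k; [exact: (Ck_row _ _ Uo).1 (ws k) j|exact: Ck_cst].
Qed.
End Chain.

(** * Values of 1-forms along maps *)

Section FormValue.
Context {R : realType} {d : nat} {M : smooth_space R d} (Mm : is_manifold M).
Implicit Types (A : form1 M) (V : normedModType R) (c : chart R d M).

(* The pullback of [A] along [p], evaluated on the vector [v]. By
   [formval_chart] any chart around [p y] gives the same value. *)
Definition formval {V} A (p : V -> M) (y v : V) : R[i] :=
  pairing (A (chart_at (p y)) (p y)) ('D_v (cmap (chart_at (p y)) \o p) y).

(** Between two charts the chain rule changes the velocity by the derivative of the transition map,
    and the compatibility clause of [is_form1] changes the covector by the transpose of that
    derivative. *)
Lemma formval_chart {V} A (p : V -> M) y v c : is_form1 A -> diff_at p y ->
  atlas c -> cdom c (p y) -> formval A p y v = pairing (A c (p y)) ('D_v (cmap c \o p) y).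
Proof.
move=> [_ Ac] pd ca yc; have [ca' yc'] := chart_atP Mm (p y).
rewrite /formval (derive_chart Mm v pd ca yc ca' yc').
rewrite -pairing_derive; last exact: (transition_diff Mm).
by congr pairing; apply/rowP => j; rewrite mxE -Ac.
Qed.

Lemma near_formval {V} A (p q : V -> M) y v :
  (\forall z \near y, p z = q z) -> formval A p y v = formval A q y v.
Proof.
move=> pq; rewrite /formval (nbhs_singleton pq); congr pairing.
by apply: near_eq_derive; apply: filterS pq => z /= ->.
Qed.

Lemma formval_comp {V} n A (p : 'rV[R]_n -> M) (f : V -> 'rV[R]_n) y v :
  differentiable f y -> diff_at p (f y) ->
  formval A (p \o f) y v = pairing (\row_j formval A p (f y) (delta_mx 0 j)) ('D_v f y).
Proof.
move=> fd pd; have [ca yc] := chart_atP Mm (p (f y)).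
have [_ pcd] := diff_at_chart Mm pd ca yc.
by rewrite /formval /= (derive_chain v fd pcd) pairing_derive.
Qed.

(** The derivative of [p] is controlled only where a full neighbourhood lies in [S], hence the open
    [T]. Near any point of [S] the same expression formed with a local extension [g] of [p] is
    smooth, and it equals the value of the form on [T]. *)
Lemma formval_smooth {V} A (p : V -> M) (T S : set V) v : is_form1 A ->
  open T -> T `<=` S -> smooth_into S p -> csmooth_ext T S (fun y => formval A p y v).
Proof.
move=> Af To TS ps; apply: csmooth_extP => x Sx.
have [c [K [g [ca [Ko Kx] gs pg]]]] := ps x Sx.
have KIo : open (K `&` g @^-1` cimg c).
  apply: open_preimage_on => //; first exact: (open_cimg Mm).
  by move=> y; exact: smooth_on_continuous gs.
have [xc gx] := pg x Sx Kx.
exists (K `&` g @^-1` cimg c), (fun y => pairing (A c (cinv c (g y))) ('D_v g y)).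
split.
- exact: KIo.
- by split; [exact: Kx|rewrite /= -gx; exists (p x)].
- apply: (csmooth_on_pairing KIo); last first.
    by apply: smooth_on_derive; apply: smooth_on_sub gs => y [].
  move=> j; apply: (@csmooth_on_comp_row _ _ _ _ (cimg c) g (fun y => A c (cinv c y) 0 j)).
  + exact: KIo.
  + by move=> y [].
  + by apply: smooth_on_sub gs => y [].
  + exact: Af.1.
- move=> y [Ky _] Ty; have [yc gy] := pg y (TS _ Ty) Ky.
  have nT : nbhs y S by apply: filterS TS _; exact: open_nbhs_nbhs.
  rewrite (formval_chart _ Af (smooth_into_diff_at ps nT) ca yc) -gy (cmapK Mm ca yc).
  congr pairing; apply: near_eq_derive.
  by apply: filterS2 nT (open_nbhs_nbhs (conj Ko Ky)) => z Sz Kz; have [] := pg z Sz Kz.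
Qed.

(** Compatibility between charts is the chain rule for [h \o cinv c] factored through the second
    chart. *)
Lemma dlog_form1 (h : M -> R[i]) : csmooth h -> (forall x, h x != 0) -> is_form1 (dlog h).
Proof.
move=> hs h0; split=> [c j ca|c c' x j ca ca' xc xc'].
  have Io := open_cimg Mm ca.
  apply: (@eq_csmooth_on _ _ _ (fun y => (h (cinv c y))^-1 *
      cderive (h \o cinv c) y (delta_mx 0 j))) => //.
    by move=> y yc; rewrite mxE (cinvK Mm).
  apply: csmooth_onM => //; first by apply: csmooth_onV => //; exact: hs.
  by apply: csmooth_on_derive; exact: hs.
have xi : cimg c (cmap c x) by exists x.
have [hr hi] := csmooth_diff hs ca' xc'.
have td := transition_diff Mm ca ca' xc xc'.
have E : \forall z \near cmap c x, (h \o cinv c) z = ((h \o cinv c') \o (cmap c' \o cinv c)) z.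
  have xI : (cmap c @` (cdom c `&` cdom c')) (cmap c x) by exists x.
  have := open_nbhs_nbhs (conj (open_cmap_image Mm ca (open_cdom Mm ca')) xI).
  by apply: filterS => _ [z [zc zc'] <-]; rewrite /= (cmapK Mm ca zc) (cmapK Mm ca' zc').
have tx : (cmap c' \o cinv c) (cmap c x) = cmap c' x by rewrite /= (cmapK Mm ca xc).
rewrite -tx in hr hi.
rewrite mxE (near_cderive _ E) (cderive_chain _ hr hi td) tx.
rewrite /pairing mulr_sumr; apply: eq_bigr => k _.
by rewrite !mxE mulrA.
Qed.

Lemma formval_dlog {V} (h : M -> R[i]) (p : V -> M) y v : csmooth h -> diff_at p y ->
  formval (dlog h) p y v = (h (p y))^-1 * cderive (h \o p) y v.
Proof.
move=> hs pd; have [ca yc] := chart_atP Mm (p y).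
have [pc pcd] := diff_at_chart Mm pd ca yc.
have [hr hi] := csmooth_diff hs ca yc.
have E : \forall z \near y, (h \o p) z =
    ((h \o cinv (chart_at (p y))) \o (cmap (chart_at (p y)) \o p)) z.
  by apply: filterS pc => z zc; rewrite /= (cmapK Mm).
rewrite (near_cderive _ E) (cderive_chain _ hr hi pcd) /formval /pairing mulr_sumr.
by apply: eq_bigr => j _; rewrite !mxE mulrA.
Qed.

Lemma formval_eq {V} A B (p : V -> M) y v : form_eq A B ->
  formval A p y v = formval B p y v.
Proof. by move=> AB; rewrite /formval AB //; have [] := chart_atP Mm (p y). Qed.

Lemma formvalD {V} A B (p : V -> M) y v :
  formval (fun c x => A c x + B c x) p y v = formval A p y v + formval B p y v.
Proof. exact: pairingDl. Qed.

Lemma formvalN {V} A (p : V -> M) y v :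
  formval (fun c x => - A c x) p y v = - formval A p y v.
Proof. exact: pairingNl. Qed.

Lemma is_form1D A B : is_form1 A -> is_form1 B -> is_form1 (fun c x => A c x + B c x).
Proof.
move=> [As Ac] [Bs Bc]; split=> [c j ca|c c' x j ca ca' xc xc'].
  apply: (@eq_csmooth_on _ _ _ (fun y => A c (cinv c y) 0 j + B c (cinv c y) 0 j)).
  - exact: (open_cimg Mm).
  - by move=> y _; rewrite mxE.
  - by apply: csmooth_onD; [exact: (open_cimg Mm)|exact: As|exact: Bs].
by rewrite mxE (Ac c c') // (Bc c c') // pairingDl.
Qed.

Lemma is_form1N A : is_form1 A -> is_form1 (fun c x => - A c x).
Proof.
move=> [As Ac]; split=> [c j ca|c c' x j ca ca' xc xc'].
  apply: (@eq_csmooth_on _ _ _ (fun y => -1 * A c (cinv c y) 0 j)).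
  - exact: (open_cimg Mm).
  - by move=> y _; rewrite mxE mulN1r.
  - by apply: csmooth_onM; [exact: (open_cimg Mm)|exact: csmooth_on_cst|exact: As].
by rewrite mxE (Ac c c') // pairingNl.
Qed.

Lemma eq_is_form1 A B : form_eq A B -> is_form1 B -> is_form1 A.
Proof.
move=> AB [Bs Bc]; split=> [c j ca|c c' x j ca ca' xc xc'].
  apply: (@eq_csmooth_on _ _ _ (fun y => B c (cinv c y) 0 j)); last exact: Bs.
    exact: (open_cimg Mm).
  by move=> y yc; rewrite AB //; exact: (cimg_cdom Mm).
by rewrite !AB // (Bc c c').
Qed.

End FormValue.

Section Pullback.
Context {R : realType} {d e : nat} {M : smooth_space R d} {N : smooth_space R e}.
Context (Mm : is_manifold M) (Nm : is_manifold N) (f : M -> N) (fs : smooth_map f).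
Implicit Types (A : form1 N) (V : normedModType R).

(** The components of a pullback are values along an inverse chart, so smoothness and compatibility
    of pullbacks become instances of [formval_smooth] and [formval_comp]. *)
Lemma pullbackE A c x : atlas c -> cdom c x ->
  pullback f A c x = \row_j formval A (f \o cinv c) (cmap c x) (delta_mx 0 j).
Proof.
move=> ca xc; apply/rowP => j; rewrite [LHS]mxE [RHS]mxE /formval.
by have -> : (f \o cinv c) (cmap c x) = f x by rewrite /= (cmapK Mm ca xc).
Qed.

Lemma formval_pullback {V} A (p : V -> M) y v : diff_at p y ->
  formval (pullback f A) p y v = formval A (f \o p) y v.
Proof.
move=> pd; have [ca yc] := chart_atP Mm (p y).
have [pc pcd] := diff_at_chart Mm pd ca yc.
have yi : cimg (chart_at (p y)) (cmap (chart_at (p y)) (p y)) by exists (p y).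
have fpd : diff_at (f \o cinv (chart_at (p y))) (cmap (chart_at (p y)) (p y)).
  by apply: (smooth_map_diff_at Mm Nm fs); exact: (diff_at_cinv Mm).
have E : \forall z \near y, (f \o p) z =
    ((f \o cinv (chart_at (p y))) \o (cmap (chart_at (p y)) \o p)) z.
  by apply: filterS pc => z zc; rewrite /= (cmapK Mm).
rewrite (near_formval _ _ E) (formval_comp Nm _ _ pcd fpd).
by rewrite {1}/formval (pullbackE _ ca yc).
Qed.

Lemma pullback_form1 A : is_form1 A -> is_form1 (pullback f A).
Proof.
move=> Af.
have fcs c : atlas c -> smooth_into (cimg c) (f \o cinv c).
  by move=> ca; apply: (smooth_map_into Mm Nm fs); exact: (smooth_into_cinv Mm).
split=> [c j ca|c c' x j ca ca' xc xc'].
  have Io := open_cimg Mm ca.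
  apply: (@eq_csmooth_on _ _ _ (fun y => formval A (f \o cinv c) y (delta_mx 0 j))) => //.
    by move=> y yc; rewrite (pullbackE _ ca (cimg_cdom Mm ca yc)) (cinvK Mm ca yc) mxE.
  apply: csmooth_ext_open => //.
  by apply: (formval_smooth Nm) => //; exact: fcs.
have td := transition_diff Mm ca ca' xc xc'.
have xi' : cimg c' (cmap c' x) by exists x.
have E : \forall z \near cmap c x, (f \o cinv c) z = ((f \o cinv c') \o (cmap c' \o cinv c)) z.
  have xI : (cmap c @` (cdom c `&` cdom c')) (cmap c x) by exists x.
  have := open_nbhs_nbhs (conj (open_cmap_image Mm ca (open_cdom Mm ca')) xI).
  by apply: filterS => _ [z [zc zc'] <-]; rewrite /= (cmapK Mm ca zc) (cmapK Mm ca' zc').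
have tx : (cmap c' \o cinv c) (cmap c x) = cmap c' x by rewrite /= (cmapK Mm ca xc).
have fd : diff_at (f \o cinv c') ((cmap c' \o cinv c) (cmap c x)).
  by rewrite tx; apply: (smooth_map_diff_at Mm Nm fs); exact: (diff_at_cinv Mm).
rewrite (pullbackE _ ca xc) mxE (near_formval _ _ E) (formval_comp Nm _ _ td fd) tx.
by rewrite -(pullbackE _ ca' xc').
Qed.
End Pullback.

(** * Path integrals *)

Section PathIntegral.
Context {R : realType} {d : nat} {M : smooth_space R d} (Mm : is_manifold M).
Implicit Types (A B : form1 M) (a b : R) (p q : R -> M).

Lemma path_integralE A a b p :
  path_integral A a b p = cintegral a b (fun t => formval A p t (1 : R)).
Proof.
by apply: (congr1 (cintegral a b)); apply/funext => t; rewrite /formval derive1E.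
Qed.

Lemma formval_cont_ext A a b p : a < b -> is_form1 A ->
  smooth_into (`[a, b] : set R) p ->
  cont_ext a b (fun t => complex.Re (formval A p t (1 : R))) /\
  cont_ext a b (fun t => complex.Im (formval A p t (1 : R))).
Proof.
move=> ab Af ps.
have To : open (`]a, b[%classic : set R) by exact: interval_open.
have TS : `]a, b[%classic `<=` `[a, b]%classic by exact: subset_itv_oo_cc.
have [fr fi] := formval_smooth Mm (1 : R) Af To TS ps.
by split; exact: smooth_ext_cont_ext.
Qed.

Lemma near_itvoo a b t : t \in `]a, b[ -> \forall s \near t, s \in `[a, b].
Proof.
move=> tab; apply: filterS (near_in_itvoo tab) => s; exact: subset_itv_oo_cc.
Qed.

Lemma smooth_into_itv_diff_at a b p t : smooth_into (`[a, b] : set R) p ->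
  t \in `]a, b[ -> diff_at p t.
Proof. by move=> ps tab; apply: (smooth_into_diff_at ps); exact: near_itvoo. Qed.

Lemma eq_cintegral a b (f g : R -> R[i]) :
  cont_ext a b (fun t => complex.Re (f t)) -> cont_ext a b (fun t => complex.Im (f t)) ->
  {in `]a, b[, f =1 g} -> cintegral a b f = cintegral a b g.
Proof.
move=> fr fi fg; rewrite /cintegral; congr (_ +i* _).
  apply: (eq_itv_integral fr) => [|t /fg ->] //.
  by apply: cont_ext_eq fr => t /fg ->.
apply: (eq_itv_integral fi) => [|t /fg ->] //.
by apply: cont_ext_eq fi => t /fg ->.
Qed.

Lemma eq_path_integral A a b p q : a < b -> is_form1 A ->
  smooth_into (`[a, b] : set R) p -> {in `[a, b], p =1 q} ->
  path_integral A a b p = path_integral A a b q.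
Proof.
move=> ab Af ps pq; rewrite !path_integralE.
have [fr fi] := formval_cont_ext ab Af ps.
apply: (eq_cintegral fr fi) => t tab; apply: near_formval.
by apply: filterS (near_itvoo tab) => s /pq.
Qed.

Lemma path_integralD A B a b p : a < b -> is_form1 A -> is_form1 B ->
  smooth_into (`[a, b] : set R) p ->
  path_integral (fun c x => A c x + B c x) a b p =
  path_integral A a b p + path_integral B a b p.
Proof.
move=> ab Af Bf ps; rewrite !path_integralE.
have [Ar Ai] := formval_cont_ext ab Af ps.
have [Br Bi] := formval_cont_ext ab Bf ps.
have [_ Er] := cont_extD Ar Br; have [_ Ei] := cont_extD Ai Bi.
rewrite /cintegral; apply: eq_complex_parts; rewrite /=.
  rewrite -[RHS]Er; apply: (congr1 (itv_integral a b)); apply/funext => t.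
  by rewrite formvalD; case: (formval A p t 1) (formval B p t 1) => [? ?] [? ?].
rewrite -[RHS]Ei; apply: (congr1 (itv_integral a b)); apply/funext => t.
by rewrite formvalD; case: (formval A p t 1) (formval B p t 1) => [? ?] [? ?].
Qed.

Lemma path_integralN A a b p : a < b -> is_form1 A -> smooth_into (`[a, b] : set R) p ->
  path_integral (fun c x => - A c x) a b p = - path_integral A a b p.
Proof.
move=> ab Af ps; apply/eqP; rewrite -addr_eq0 -(path_integralD ab (is_form1N Mm Af) Af ps).
rewrite path_integralE.
have E : (fun t => formval (fun c x => - A c x + A c x) p t (1 : R)) = fun=> 0.
  by apply/funext => t; rewrite formvalD formvalN addNr.
rewrite E /cintegral; apply/eqP; apply: eq_complex_parts; rewrite /= Rintegral_cst //; exact: mul0r.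
Qed.

Lemma eq_form_path_integral A B a b p : form_eq A B ->
  path_integral A a b p = path_integral B a b p.
Proof.
by move=> AB; rewrite !path_integralE; apply: (congr1 (cintegral a b)); apply/funext => t; exact: formval_eq.
Qed.

Lemma itv_integral_split a b c (w : R -> R) : a < b -> b < c -> cont_ext a c w ->
  itv_integral a c w = itv_integral a b w + itv_integral b c w.
Proof.
move=> ab bc wc; have [v vc wv] := wc.
have sl : `[a, b]%classic `<=` `[a, c]%classic by apply: subset_itvl; rewrite bnd_simp ltW.
have sr : `[b, c]%classic `<=` `[a, c]%classic by apply: subset_itvr; rewrite bnd_simp ltW.
have vl : {within `[a, b], continuous v} := continuous_subspaceW sl vc.
have vr : {within `[b, c], continuous v} := continuous_subspaceW sr vc.
have wl : {in `]a, b[, w =1 v}.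
  by move=> t; rewrite in_itv /= => /andP[at_ tb]; apply: wv; rewrite in_itv /= at_ (lt_trans tb).
have wr : {in `]b, c[, w =1 v}.
  by move=> t; rewrite in_itv /= => /andP[bt tc]; apply: wv; rewrite in_itv /= tc (lt_trans ab).
have wlc : cont_ext a b w by exists v.
have wrc : cont_ext b c w by exists v.
rewrite (eq_itv_integral wc (within_cont_ext vc)) // (eq_itv_integral wlc (within_cont_ext vl)) //.
rewrite (eq_itv_integral wrc (within_cont_ext vr)) //.
have vi := within_integrable vc; have vir := within_integrable vr.
have vir' : lebesgue_measure.-integrable `]b, c] (EFin \o v).
  by apply: integrableS vir => //; exact: subset_itv_oc_cc.
rewrite /itv_integral -(Rintegral_itv_obnd_cbnd vir') -(Rintegral_itvB vi (x := b)).
- by rewrite addrC subrK.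
- by rewrite bnd_simp ltW.
- by rewrite bnd_simp ltW.
Qed.

Lemma path_integral_split A a b c p : a < b -> b < c -> is_form1 A ->
  smooth_into (`[a, c] : set R) p ->
  path_integral A a c p = path_integral A a b p + path_integral A b c p.
Proof.
move=> ab bc Af ps; rewrite !path_integralE.
have [fr fi] := formval_cont_ext (lt_trans ab bc) Af ps.
rewrite /cintegral -!/(itv_integral _ _ _) (itv_integral_split ab bc fr).
by rewrite (itv_integral_split ab bc fi).
Qed.

Lemma smooth_ext_within a b (f : R -> R^o) :
  smooth_ext (`[a, b] : set R) (`[a, b] : set R) f -> {within `[a, b], continuous f}.
Proof.
move=> fs; apply/subspace_continuousP => t tab.
have [K [g [Ko Kt gs fg]]] := fs t tab.
have nK := open_nbhs_nbhs (conj Ko Kt).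
have gc : g x @[x --> within `[a, b] (nbhs t)] --> f t.
  by rewrite (fg t Kt tab); apply: cvg_within_filter; exact: (smooth_on_continuous gs Kt).
apply: cvg_trans gc; apply: near_eq_cvg.
by rewrite /within /=; apply: filterS nK => s Ks sab; exact/esym/(fg s Ks sab).
Qed.

Lemma cexp_path_integral_dlog (h : M -> R[i]) a b p : a < b -> csmooth h ->
  (forall x, h x != 0) -> smooth_into (`[a, b] : set R) p ->
  cexp (path_integral (dlog h) a b p) = h (p b) * (h (p a))^-1.
Proof.
move=> ab hs h0 ps; rewrite path_integralE.
have [hr hi] := csmooth_into Mm hs ps.
have [dr di] := formval_cont_ext ab (dlog_form1 Mm hs h0) ps.
apply: (@cexp_integral_dlog _ a b (h \o p)) => //.
- exact: smooth_ext_within hr.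
- exact: smooth_ext_within hi.
- by move=> t _; exact: h0.
- move=> t tab; have [d1 d2] := csmooth_diff_at Mm hs (smooth_into_itv_diff_at ps tab).
  by split; exact: diff_derivable.
- move=> t tab; apply: (formval_dlog Mm _ hs); exact: smooth_into_itv_diff_at ps tab.
Qed.

Lemma open_setX {X Y : topologicalType} (U : set X) (T : set Y) :
  open U -> open T -> open (U `*` T).
Proof.
move=> Uo To; rewrite openE => -[x y] [/= Ux Ty].
by exists (U, T) => //=; split; exact: open_nbhs_nbhs.
Qed.

Lemma derive_snd {r} {W : normedModType R} (g : 'rV[R]_r * R -> W) u t :
  'D_((0, 1) : 'rV[R]_r * R) g (u, t) = 'D_(1 : R) (fun t => g (u, t)) t.
Proof.
rewrite /derive.
suff E : (fun h : R => h^-1 *: ((g \o shift (u, t)) (h *: ((0, 1) : 'rV[R]_r * R)) - g (u, t))) =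
         (fun h : R => h^-1 *: (((fun t => g (u, t)) \o shift t) (h *: (1 : R)) - g (u, t))).
  by rewrite E.
apply/funext => h /=.
have -> : h *: ((0, 1) : 'rV[R]_r * R) + (u, t) = (u, h *: (1 : R) + t).
  by congr pair; rewrite /= scaler0 add0r.
by [].
Qed.

(** Viewed as one map on [U * [a, b]], the family has the integrand as its [formval] in the
    direction [(0, 1)]. So [formval_smooth] gives smoothness jointly in [u] and [t], up to the end
    points in [t], as [param_integral_smooth] requires. *)
Lemma path_integral_smooth r (U : set 'rV[R]_r) A a b (p : 'rV[R]_r -> R -> M) :
  a < b -> open U -> is_form1 A ->
  smooth_into (U `*` (`[a, b] : set R)) (fun ut : 'rV[R]_r * R => p ut.1 ut.2) ->
  csmooth_on U (fun u => path_integral A a b (p u)).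
Proof.
move=> ab Uo Af ps.
have To : open (`]a, b[%classic : set R) by exact: interval_open.
have UTo : open (U `*` `]a, b[%classic) by exact: open_setX.
have TS : U `*` `]a, b[%classic `<=` U `*` `[a, b]%classic.
  by move=> [u t] [/= Uu tab]; split => //=; exact: subset_itv_oo_cc.
have [fr fi] := formval_smooth Mm ((0, 1) : 'rV[R]_r * R) Af UTo TS ps.
have E u t : U u -> t \in `]a, b[ ->
    formval A (fun ut : 'rV[R]_r * R => p ut.1 ut.2) (u, t) (0, 1) = formval A (p u) t (1 : R).
  move=> Uu tab; rewrite /formval; congr pairing; exact: derive_snd.
pose wr u t : R := complex.Re (formval A (p u) t (1 : R)).
pose wi u t : R := complex.Im (formval A (p u) t (1 : R)).
have wrP : param_ext a b U wr.
  move=> z /fr[N [g [No Nz gs fg]]]; exists N, g; split; [exact: No|exact: Nz|exact: gs|].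
  by move=> [u t] Ny [/= Uu tab]; rewrite /wr -(E u t Uu tab); exact: (fg (u, t) Ny (conj Uu tab)).
have wiP : param_ext a b U wi.
  move=> z /fi[N [g [No Nz gs fg]]]; exists N, g; split; [exact: No|exact: Nz|exact: gs|].
  by move=> [u t] Ny [/= Uu tab]; rewrite /wi -(E u t Uu tab); exact: (fg (u, t) Ny (conj Uu tab)).
apply: (@eq_csmooth_on _ _ U (fun u => (itv_integral a b (wr u) +i* itv_integral a b (wi u))) _ Uo).
  by move=> u _; exact: (esym (path_integralE A a b (p u))).
by split; [exact: (param_integral_smooth ab Uo wrP)|exact: (param_integral_smooth ab Uo wiP)].
Qed.
End PathIntegral.

Lemma path_integral_pullback {R : realType} {d e} {M : smooth_space R d}
    {N : smooth_space R e} (Mm : is_manifold M) (Nm : is_manifold N)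
    (f : M -> N) (A : form1 N) (a b : R) (p : R -> M) :
  smooth_map f -> a < b -> is_form1 A -> smooth_into (`[a, b] : set R) p ->
  path_integral (pullback f A) a b p = path_integral A a b (f \o p).
Proof.
move=> fs ab Af ps; rewrite !path_integralE.
have [fr fi] := formval_cont_ext Mm ab (pullback_form1 Mm Nm fs Af) ps.
apply: (eq_cintegral fr fi) => t tab.
exact: (formval_pullback Mm Nm fs A _ (smooth_into_itv_diff_at ps tab)).
Qed.

Lemma path_integral0 {R : realType} {d} {M : smooth_space R d} (a b : R) (p : R -> M) :
  path_integral (fun _ _ => 0) a b p = 0.
Proof.
rewrite path_integralE.
have -> : (fun t => formval (fun _ _ => 0) p t (1 : R)) = fun=> 0.
  by apply/funext => t; exact: pairing0l.
by rewrite /cintegral; apply: eq_complex_parts; rewrite /= Rintegral_cst //; exact: mul0r.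
Qed.

Lemma csmoothM {R : realType} {d} {M : smooth_space R d} (f g : M -> R[i]) :
  is_manifold M -> csmooth f -> csmooth g -> csmooth (fun x => f x * g x).
Proof.
move=> Mm fs gs c ca.
exact: (csmooth_onM (open_cimg Mm ca) (fs c ca) (gs c ca)).
Qed.

Lemma csmoothV {R : realType} {d} {M : smooth_space R d} (f : M -> R[i]) :
  is_manifold M -> (forall x, f x != 0) -> csmooth f -> csmooth (fun x => (f x)^-1).
Proof.
move=> Mm f0 fs c ca.
exact: (csmooth_onV (open_cimg Mm ca) (fun x _ => f0 (cinv c x)) (fs c ca)).
Qed.

(** In the application [q] and [p] are the exponentials of the integrals along the target and source
    paths, [p'] is the inverse of [p], [z] is the exponential of the integral of [dlog h], and [u],
    [v] are the values of [h] at the two ends of the path of arrows. The last hypothesis is the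
    exponential of the integrated cocycle equation. *)
Lemma mul_inverse_solve {F : fieldType} (q p' p z u v : F) : u != 0 -> v != 0 ->
  p' * p = 1 -> z = v * u^-1 -> q * p' * z = 1 -> q = p * (u * v^-1).
Proof.
move=> u0 v0 pp -> E; rewrite -[q]mulr1 -pp -[q * (p' * p)]mulr1 -(divff u0) -[RHS]mul1r -E.
by field; rewrite u0 v0.
Qed.

(** [F' i] and [F' i.+1] are the two parts of the factor [F i] that is split; later factors move up
    by one index. *)
Lemma prod_insert {S : comNzRingType} (F F' : nat -> S) i n : (i < n)%N ->
  (forall j, (j < i)%N -> F' j = F j) -> F' i * F' i.+1 = F i ->
  (forall k, (i <= k)%N -> (k.+1 < n)%N -> F' k.+2 = F k.+1) ->
  \prod_(j < n) F j = \prod_(j < n.+1) F' j.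
Proof.
move=> iN Flt Fi Fgt; rewrite -(big_mkord xpredT F) -(big_mkord xpredT F').
rewrite (big_cat_nat (leq0n i) (ltnW iN)) /=.
rewrite [RHS](big_cat_nat (leq0n i) (ltnW (ltnW iN : (i < n.+1)%N))) /=.
rewrite (big_ltn iN) [X in _ = _ * X](big_ltn (ltnW iN : (i < n.+1)%N)).
rewrite [X in _ = _ * (_ * X)](big_ltn (iN : (i.+1 < n.+1)%N)) (mulrA (F' i)) Fi.
congr (_ * (_ * _)); first by apply: eq_big_nat => j /andP[_ ji]; rewrite Flt.
rewrite [RHS]big_add1 /=; apply: eq_big_nat => -[//|j] /andP[ij jn].
by rewrite Fgt.
Qed.

(** * Holonomy *)

Section Partition.
Context {R : realType}.
Implicit Types W : partition01 R.

Lemma knot_lt W i : (i < npieces W)%N -> knot W i < knot W i.+1.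
Proof. by move=> iW; have /(pathP 0) := ppts_sorted W; apply. Qed.

Lemma npieces_gt0 W : (0 < npieces W)%N.
Proof.
rewrite /npieces lt0n; apply/eqP => /size0nil W0.
by have := ppts_last W; rewrite W0 /= => /eqP; rewrite eq_sym oner_eq0.
Qed.

Lemma knot_last W : knot W (npieces W) = 1.
Proof. by rewrite -(ppts_last W) (last_nth 0). Qed.

Lemma seg_left W i : (i < npieces W)%N -> knot W i \in seg W i.
Proof. by move=> iW; rewrite inE /seg /= in_itv /= lexx ltW // knot_lt. Qed.

Lemma seg_right W i : (i < npieces W)%N -> knot W i.+1 \in seg W i.
Proof. by move=> iW; rewrite inE /seg /= in_itv /= lexx ltW // knot_lt. Qed.

Lemma next_piece_comp {X Y} W (g : X -> Y) (p : nat -> R -> X) i t :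
  g (next_piece W p i t) = next_piece W (fun j s => g (p j s)) i t.
Proof. by rewrite /next_piece; case: ifP. Qed.

(** The cyclic shift behind all telescoping: the piece after the [i]-th one starts at the knot
    [i.+1], and after the last piece the circle closes because [1 - 1] is the knot 0. *)
Lemma prod_next_piece {S : comNzRingType} W (u : nat -> R -> S) :
  \prod_(i < npieces W) next_piece W u i (knot W i.+1) =
  \prod_(i < npieces W) u i (knot W i).
Proof.
have := npieces_gt0 W; have := knot_last W; rewrite /next_piece.
case: (npieces W) => [//|n] Wn _; rewrite big_ord_recr big_ord_recl /= ltnn Wn subrr.
rewrite mulrC; congr (_ * _); apply: eq_bigr => i _.
by rewrite ltnS ltn_ord.
Qed.

(** [ppts] omits the knot 0, so position [i] of the list is the knot [i.+1]. *)
Lemma knot_insert W W' i b j : (i < npieces W)%N ->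
  ppts W' = take i (ppts W) ++ b :: drop i (ppts W) ->
  [/\ (j <= i)%N -> knot W' j = knot W j, knot W' i.+1 = b &
      (i <= j)%N -> knot W' j.+2 = knot W j.+1].
Proof.
rewrite /npieces /knot => iW ->; have st := size_takel (ltnW iW).
split.
- case: j => [//|j] ji /=; rewrite nth_cat st ji nth_take //.
- by rewrite /= nth_cat st ltnn subnn.
- move=> ij; rewrite /= nth_cat st ltnNge (leq_trans ij) //= subSn //= nth_drop subnKC //.
Qed.
End Partition.

Section Holonomy.
Context {R : realType} {d : nat} {G : etale_groupoid R d}.
Implicit Types (c : pre_cech1 G) (psi phi : pre_loop G).

Let Om : is_manifold (ob G) := ob_manifold G.
Let Am : is_manifold (ar G) := ar_manifold G.

Lemma gsrc_smooth : smooth_map (gsrc (e := G)).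
Proof. exact/local_diffeo_smooth/gsrc_etale. Qed.

Lemma gtgt_smooth : smooth_map (gtgt (e := G)).
Proof. exact/local_diffeo_smooth/gtgt_etale. Qed.

Lemma gid_smooth : smooth_map (gid (e := G)).
Proof. exact/local_diffeo_smooth/gid_etale. Qed.

(* Equal to [c] on cocycles. Dividing out the value at units makes the
   holonomy of an arbitrary cochain invariant under insertion of knots. *)
Definition normalize c : pre_cech1 G :=
  (fun g => c.1 g * (c.1 (gid (gsrc g)))^-1, c.2).

Definition transgression c psi : R[i] := holonomy (normalize c) psi.

Lemma normalize_id c x : c.1 (gid x) != 0 -> (normalize c).1 (gid x) = 1.
Proof. by move=> c0; rewrite /normalize /= gsrc_id divff. Qed.

Lemma normalize_cech1 c : cech1 c -> cech1 (normalize c).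
Proof.
move=> [cs c0 cA]; split=> //; last by move=> g; rewrite mulf_neq0 ?invr_neq0.
have is_ := csmooth_comp Om Am cs gid_smooth.
apply: (csmoothM Am cs); apply: (csmoothV Am) => [g|]; first exact: c0.
exact: (csmooth_comp Am Om is_ gsrc_smooth).
Qed.

(** Each interval is grouped with the arrow at its right end, so identities between holonomies
    become identities between factors. *)
Definition hol_factor c psi i : R[i] :=
  cexp (path_integral c.2 (knot (lpart psi) i) (knot (lpart psi) i.+1) (piece psi i)) *
  (c.1 (jump psi i))^-1.

Lemma holonomyE c psi : holonomy c psi = \prod_(i < npieces (lpart psi)) hol_factor c psi i.
Proof. by rewrite /holonomy cexp_sum -big_split. Qed.

Lemma holonomy_neq0 c psi : (forall g, c.1 g != 0) -> holonomy c psi != 0.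
Proof.
move=> c0; rewrite holonomyE; apply/prodf_neq0 => i _.
by rewrite mulf_neq0 ?cexp_neq0 ?invr_neq0.
Qed.

Lemma loop_piece_smooth psi i : is_loop psi -> (i < npieces (lpart psi))%N ->
  smooth_into (`[knot (lpart psi) i, knot (lpart psi) i.+1] : set R) (piece psi i).
Proof. by move=> psiL iW; have [] := psiL i iW. Qed.

Lemma holonomy_same c psi phi : is_form1 c.2 -> is_loop psi -> same_loop psi phi ->
  holonomy c psi = holonomy c phi.
Proof.
move=> cA psiL [Wpp pp]; rewrite !holonomyE -Wpp; apply: eq_bigr => i _.
have [pE jE] := pp i (ltn_ord i); rewrite /hol_factor -Wpp jE.
rewrite (eq_path_integral Om (knot_lt (ltn_ord i)) cA (q := piece phi i)) //.
  exact: loop_piece_smooth.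
by move=> t tab; apply: pE; rewrite inE.
Qed.

(** [unbump i] sends both new indices [i] and [i.+1] to the old index [i]. The left part ends in a
    unit arrow, where [c.1] is 1; the right part keeps the old arrow, so the two factors multiply to
    the old one. *)
Lemma holonomy_insertion c i b psi phi : is_form1 c.2 -> (forall x, c.1 (gid x) = 1) ->
  is_loop psi -> is_loop phi -> insertion i b psi phi -> holonomy c psi = holonomy c phi.
Proof.
move=> cA c1 psiL phiL [iW Wphi pp].
have nE : npieces (lpart phi) = (npieces (lpart psi)).+1.
  by rewrite /npieces Wphi size_cat /= addnS -size_cat cat_take_drop.
have Kle j : (j <= i)%N -> knot (lpart phi) j = knot (lpart psi) j.
  by move=> ji; have [/(_ ji)] := knot_insert j iW Wphi.
have Kb : knot (lpart phi) i.+1 = b by have [_] := knot_insert 0 iW Wphi.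
have Kge j : (i <= j)%N -> knot (lpart phi) j.+2 = knot (lpart psi) j.+1.
  by move=> ij; have [_ _ /(_ ij)] := knot_insert j iW Wphi.
have pieceE j : (j <= npieces (lpart psi))%N -> path_integral c.2 (knot (lpart phi) j)
    (knot (lpart phi) j.+1) (piece phi j) = path_integral c.2 (knot (lpart phi) j)
    (knot (lpart phi) j.+1) (piece psi (unbump i j)).
  move=> jn; have jn' : (j < npieces (lpart phi))%N by rewrite nE.
  have [pE _] := pp j jn'.
  apply: (eq_path_integral Om (knot_lt jn') cA); first exact: loop_piece_smooth.
  by move=> t tab; apply: pE; rewrite inE.
have jumpE j : (j <= npieces (lpart psi))%N -> j != i -> jump phi j = jump psi (unbump i j).
  by move=> jn ji; have [|_ ->] := pp j; rewrite ?nE ?(negbTE ji).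
have jumpi : jump phi i = gid (piece psi i b).
  by have [|_ ->] := pp i; rewrite ?nE ?eqxx // ltnW.
have Flt j : (j < i)%N -> hol_factor c phi j = hol_factor c psi j.
  move=> ji; have jn : (j <= npieces (lpart psi))%N by rewrite ltnW // (ltn_trans ji).
  have uj : unbump i j = j by rewrite /unbump ltnNge ltnW // subn0.
  have nji : j != i by rewrite ltn_eqF.
  by rewrite /hol_factor (pieceE j jn) (jumpE j jn nji) uj (Kle j (ltnW ji)) (Kle j.+1 ji).
have Fgt k : (i <= k)%N -> (k.+1 < npieces (lpart psi))%N ->
    hol_factor c phi k.+2 = hol_factor c psi k.+1.
  move=> ik kn; have uk : unbump i k.+2 = k.+1 by rewrite /unbump ltnS ltnW // subn1.
  have nki : k.+2 != i by rewrite gtn_eqF // ltnS ltnW.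
  by rewrite /hol_factor (pieceE _ kn) (jumpE _ kn nki) uk (Kge k ik) (Kge k.+1 (leqW ik)).
have Fi : hol_factor c phi i * hol_factor c phi i.+1 = hol_factor c psi i.
  have ui : unbump i i = i by rewrite /unbump ltnn subn0.
  have ui1 : unbump i i.+1 = i by rewrite /unbump ltnSn subn1.
  have nji : i.+1 != i by rewrite gtn_eqF.
  have ib : knot (lpart psi) i < b.
    by have := @knot_lt _ (lpart phi) i; rewrite (Kle i (leqnn i)) Kb nE ltnS; apply; exact: ltnW.
  have bi : b < knot (lpart psi) i.+1.
    by have := @knot_lt _ (lpart phi) i.+1; rewrite (Kge i (leqnn i)) Kb nE; apply.
  have -> : hol_factor c phi i = cexp (path_integral c.2 (knot (lpart psi) i) b (piece psi i)).
    rewrite /hol_factor (pieceE i (ltnW iW)) jumpi c1 ui (Kle i (leqnn i)) Kb.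
    exact: divr1.
  rewrite /hol_factor (pieceE i.+1 iW) (jumpE i.+1 iW nji) ui1 Kb (Kge i (leqnn i)).
  rewrite (path_integral_split Om ib bi cA (loop_piece_smooth psiL iW)) cexpD.
  exact: mulrA.
by rewrite !holonomyE nE; exact: (prod_insert iW Flt Fi Fgt).
Qed.

Lemma holonomy_smooth c r (U : set 'rV[R]_r) Psi : cech1 c -> open U ->
  smooth_family (G := G) U Psi -> csmooth_on U (holonomy c \o Psi).
Proof.
move=> [cs c0 cA] Uo [W [UW Ws]].
apply: (@eq_csmooth_on _ _ U (fun u => \prod_(i < npieces W)
  (cexp (path_integral c.2 (knot W i) (knot W i.+1) (piece (Psi u) i)) *
   (c.1 (jump (Psi u) i))^-1)) _ Uo).
  by move=> u /UW[_ WE]; rewrite /= holonomyE /hol_factor WE.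
apply: csmooth_on_prod => // i; have [ps js] := Ws i (ltn_ord i).
apply: csmooth_onM => //.
  apply: csmooth_on_exp => //.
  exact: (path_integral_smooth Om (knot_lt (ltn_ord i)) Uo cA ps).
apply: (csmooth_onV Uo (fun u _ => c0 (jump (Psi u) i))).
exact: (csmooth_ext_open Uo (csmooth_into Am cs js)).
Qed.

Lemma transgression_cech0 c : cech1 c -> loop_cech0 (transgression c).
Proof.
move=> cc; have nc := normalize_cech1 cc; have [ns n0 nA] := nc.
have n1 x : (normalize c).1 (gid x) = 1 by apply: normalize_id; have [_ c0 _] := cc; exact: c0.
split.
- by move=> psi _; exact: holonomy_neq0.
- by move=> psi phi psiL _; exact: holonomy_same.
- by move=> i b psi phi; exact: holonomy_insertion.
- by move=> r U Psi; exact: holonomy_smooth.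
Qed.

Lemma transgressionM c c' psi : cech1 c -> cech1 c' -> is_loop psi ->
  transgression (cech1_mul c c') psi = transgression c psi * transgression c' psi.
Proof.
move=> [_ _ cA] [_ _ cA'] psiL; rewrite /transgression !holonomyE -big_split.
apply: eq_bigr => i _; rewrite /hol_factor /=.
rewrite (path_integralD Om (knot_lt (ltn_ord i)) cA cA' (loop_piece_smooth psiL (ltn_ord i))).
rewrite cexpD !invfM !invrK.
set x := cexp _; set y := cexp _; set h := (c.1 _)^-1; set h' := (c'.1 _)^-1.
by rewrite (mulrACA h) (mulrACA x).
Qed.

Lemma cocycle1_mul c g1 g2 : cocycle1 c -> gtgt g1 = gsrc g2 ->
  c.1 (gcmp g1 g2) = c.1 g1 * c.1 g2.
Proof.
move=> [[_ c0 _] c1 _] g12; have := c1 g1 g2 g12; rewrite /=.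
by move=> /(congr1 ( *%R (c.1 (gcmp g1 g2)))); rewrite mulr1 mulrAC mulrCA mulfV // mulr1 mulrC.
Qed.

(** A unit is idempotent, so the value there is nonzero and equal to its square. *)
Lemma cocycle1_id c x : cocycle1 c -> c.1 (gid x) = 1.
Proof.
move=> cc; have [[_ c0 _] _ _] := cc.
have e : gcmp (gid x) (gid x) = gid x by have := gcmp1g (gid x); rewrite gsrc_id.
have := @cocycle1_mul c (gid x) (gid x) cc; rewrite gtgt_id gsrc_id e => /(_ erefl) E.
by apply: (mulfI (c0 (gid x))); rewrite -E mulr1.
Qed.

Lemma transgression_cocycle c psi : cocycle1 c -> transgression c psi = holonomy c psi.
Proof.
move=> cc; rewrite /transgression !holonomyE; apply: eq_bigr => i _.
by rewrite /hol_factor /normalize /= cocycle1_id // invr1 mulr1.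
Qed.

Lemma arrow_path_integral c a b (L : R -> ar G) (p q : R -> ob G) : a < b -> cocycle1 c ->
  smooth_into (`[a, b] : set R) L ->
  {in `[a, b], gsrc (e := G) \o L =1 p} -> {in `[a, b], gtgt (e := G) \o L =1 q} ->
  cexp (path_integral c.2 a b q) =
  cexp (path_integral c.2 a b p) * (c.1 (L a) * (c.1 (L b))^-1).
Proof.
move=> ab cc Ls Lp Lq; have [[cs c0 cA] _ cf] := cc.
have sL := smooth_map_into Am Om gsrc_smooth Ls.
have tL := smooth_map_into Am Om gtgt_smooth Ls.
have sA := pullback_form1 Am Om gsrc_smooth cA.
have tA := pullback_form1 Am Om gtgt_smooth cA.
have nsA := is_form1N Am sA.
have dA := dlog_form1 Am cs c0.
have := eq_form_path_integral Am a b L cf; rewrite /cech_d1 /=.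
rewrite (path_integralD Am ab (is_form1D Am tA nsA) dA Ls) (path_integralD Am ab tA nsA Ls).
rewrite (path_integralN Am ab sA Ls).
rewrite (path_integral_pullback Am Om gsrc_smooth ab cA Ls).
rewrite (path_integral_pullback Am Om gtgt_smooth ab cA Ls).
(* The source and target of [L] are known to be [p] and [q] on the closed interval alone, which
   determines the integrals. *)
rewrite (eq_path_integral Om ab cA sL Lp) (eq_path_integral Om ab cA tL Lq).
rewrite path_integral0 => /(congr1 cexp); rewrite cexp0 !cexpD.
exact: (mul_inverse_solve (c0 _) (c0 _) (cexpN (path_integral c.2 a b p))
  (cexp_path_integral_dlog Am ab cs c0 Ls)).
Qed.

End Holonomy.

(** * Holonomy under arrows and of coboundaries *)

Section Cohomology.
Context {R : realType} {d : nat} {G : etale_groupoid R d}.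
Implicit Types (c b : pre_cech1 G) (psi phi : pre_loop G).

Let Om : is_manifold (ob G) := ob_manifold G.
Let Am : is_manifold (ar G) := ar_manifold G.

Lemma prod_telescope (F : fieldType) n (P Q x y : 'I_n -> F) :
  (forall i, Q i = P i * (x i * (y i)^-1)) ->
  \prod_(i < n) x i = \prod_(i < n) y i -> (forall i, y i != 0) ->
  \prod_(i < n) P i = \prod_(i < n) Q i.
Proof.
move=> QE xy y0; rewrite (eq_bigr _ (fun i _ => QE i)) !big_split /= xy prodfV.
by rewrite divff ?mulr1 //; apply/prodf_neq0.
Qed.

(** Here [p], [q] are the exponentials along a piece of [psi] and of [phi], [f], [g] the values of
    [h] on their jumps, [la], [lb] its values at the two ends of [L i], and [n] its value at the
    start of the next piece of [L]. The equation [lb * g = f * n] is [h] applied to the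
    compatibility of the arrow with the jumps; [lb] cancels. *)
Lemma arrow_factor {F : fieldType} (p q f g la lb n : F) : f != 0 -> g != 0 ->
  lb != 0 -> n != 0 -> q = p * (la * lb^-1) -> lb * g = f * n ->
  q * g^-1 = p * f^-1 * (la * n^-1).
Proof.
move=> f0 g0 lb0 n0 -> E.
have -> : g = f * n / lb by rewrite -E mulrAC divff ?mul1r.
by field; rewrite f0 lb0 n0.
Qed.

(** The letters [fa], [fb], [fn] are the values of [f] at the two ends of a piece and at the start
    of the next one. The integral of [- dlog f] contributes [fa / fb] and the jump [fb / fn], so the
    value at the right end cancels. *)
Lemma coboundary_factor {F : fieldType} (p z fa fb fn : F) : fa != 0 -> fb != 0 ->
  fn != 0 -> p * z = 1 -> z = fb * fa^-1 -> p * (fn * fb^-1)^-1 = fa * fn^-1.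
Proof.
move=> a0 b0 n0 pz E; have -> : p = fa / fb.
  by apply: (mulIf (x := z)); rewrite ?pz E ?mulf_neq0 ?invr_neq0 //; field; rewrite a0 b0.
by field; rewrite b0 n0.
Qed.

Lemma holonomy_arrow c psi phi L : cocycle1 c -> is_loop psi -> is_loop phi ->
  is_arrow psi phi L -> holonomy c psi = holonomy c phi.
Proof.
move=> cc psiL phiL [WE H]; have [[cs c0 cA] _ _] := cc.
rewrite !holonomyE WE.
(* [x i] is the value of [c.1] at the start of [L i], and [y i] its value at the start of the
   following piece; the values at right ends cancel inside each factor. *)
apply: (prod_telescope (x := fun i => c.1 (L i (knot (lpart psi) i)))
  (y := fun i => next_piece (lpart psi) (fun j s => c.1 (L j s)) i (knot (lpart psi) i.+1))).
- move=> i; have iW := ltn_ord i; have [Ls Lp Lq Lj] := H i iW.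
  have [_ psrc ptgt _] := psiL i iW.
  have iW' : (i < npieces (lpart phi))%N by rewrite WE.
  have [_ qsrc _ _] := phiL i iW'.
  rewrite -(next_piece_comp _ c.1 L) /hol_factor WE.
  apply: (@arrow_factor _ _ _ _ _ _ (c.1 (L i (knot (lpart psi) i.+1)))).
  + exact: c0.
  + exact: c0.
  + exact: c0.
  + exact: c0.
  + apply: (arrow_path_integral (knot_lt iW) cc Ls).
      by move=> t tab; apply: Lp; rewrite inE.
    by move=> t tab; apply: Lq; rewrite inE.
  + rewrite -(cocycle1_mul cc); last first.
      by rewrite qsrc WE -(Lq _ (seg_right iW)).
    rewrite Lj (cocycle1_mul cc) // ptgt /next_piece; case: ifP => i1W.
      have [_ Lp1 _ _] := H i.+1 i1W.
      by rewrite -(Lp1 _ (seg_left i1W)).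
    (* At the last piece [next_piece] evaluates piece 0 at [1 - 1], which is the knot 0. *)
    have n0 := npieces_gt0 (lpart psi); have [_ Lp0 _ _] := H 0%N n0.
    have -> : knot (lpart psi) i.+1 - 1 = knot (lpart psi) 0.
      have -> : i.+1 = npieces (lpart psi).
        by apply/eqP; rewrite eqn_leq iW leqNgt i1W.
      by rewrite knot_last subrr.
    by rewrite -(Lp0 _ (seg_left n0)).
- by rewrite prod_next_piece.
- by move=> i; rewrite -(next_piece_comp _ c.1 L).
Qed.

Lemma transgression_cocycle0 c : cocycle1 c -> loop_cocycle0 (transgression c).
Proof.
move=> cc; split; first by apply: transgression_cech0; have [] := cc.
move=> psi phi L psiL phiL a; rewrite !transgression_cocycle //.
exact: (holonomy_arrow cc psiL phiL a).
Qed.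

Lemma coboundary1_cech1 b : coboundary1 b -> cech1 b.
Proof.
move=> [f [fs f0] [b1 b2]].
have fsrc := csmooth_comp Am Om fs gsrc_smooth.
have ftgt := csmooth_comp Am Om fs gtgt_smooth.
split.
- have -> : b.1 = fun g => (f \o gtgt (e := G)) g * ((f \o gsrc (e := G)) g)^-1.
    by apply/funext => g; rewrite b1.
  apply: (csmoothM Am ftgt); apply: (csmoothV Am) => // g; exact: f0.
- by move=> g; rewrite b1 /= mulf_neq0 ?invr_neq0.
- by apply: (eq_is_form1 Om b2); apply: (is_form1N Om); exact: (dlog_form1 Om fs f0).
Qed.

Lemma transgression_coboundary b psi : coboundary1 b -> is_loop psi ->
  transgression b psi = 1.
Proof.
move=> [f [fs f0] [b1 b2]] psiL.
have bid x : b.1 (gid x) = 1 by rewrite b1 /= gtgt_id gsrc_id mulfV.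
rewrite /transgression holonomyE.
have dA := dlog_form1 Om fs f0.
have E i : (i < npieces (lpart psi))%N -> hol_factor (normalize b) psi i =
    f (piece psi i (knot (lpart psi) i)) *
    (next_piece (lpart psi) (fun j s => f (piece psi j s)) i (knot (lpart psi) i.+1))^-1.
  move=> iW; have ps := loop_piece_smooth psiL iW; have [_ psrc ptgt _] := psiL i iW.
  rewrite /hol_factor /normalize /= bid invr1 mulr1 b1 /= psrc ptgt.
  rewrite (eq_form_path_integral Om _ _ _ b2) (path_integralN Om (knot_lt iW) dA ps).
  rewrite -(next_piece_comp _ f).
  apply: (coboundary_factor (f0 _) (f0 _) (f0 _)
    (cexpN (path_integral (dlog f) (knot (lpart psi) i) (knot (lpart psi) i.+1) (piece psi i)))).
  exact: (cexp_path_integral_dlog Om (knot_lt iW) fs f0 ps).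
rewrite (eq_bigr _ (fun (i : 'I_(npieces (lpart psi))) _ => E i (ltn_ord i))).
rewrite big_split /= prodfV.
rewrite (prod_next_piece (lpart psi) (fun j s => f (piece psi j s))) divff //.
by apply/prodf_neq0 => i _; exact: f0.
Qed.
End Cohomology.

Lemma dlog_identity {F : fieldType} (f g x y : F) : f != 0 -> g != 0 ->
  (f * g)^-1 * (f * y + g * x) = f^-1 * x + g^-1 * y.
Proof. by move=> f0 g0; field; rewrite f0 g0. Qed.

Lemma cocycle_identity {F : fieldType} (a b a' b' : F) : a != 0 -> b != 0 ->
  a' != 0 -> b' != 0 -> b * b' * (a * b * (a' * b'))^-1 * (a * a') = 1.
Proof. by move=> a0 b0 a0' b0'; field; rewrite a0 b0 a0' b0'. Qed.

Lemma cocycle_add {Z : zmodType} (a b x a' b' x' : Z) :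
  a - b + x = 0 -> a' - b' + x' = 0 -> (a + a') - (b + b') + (x + x') = 0.
Proof. by move=> E E'; rewrite opprD (addrACA a) (addrACA (a - b)) E E' addr0. Qed.

Lemma cderiveM {R : realType} {V : normedModType R} (f g : V -> R[i]) (x v : V) :
  differentiable (fun y => complex.Re (f y) : R^o) x ->
  differentiable (fun y => complex.Im (f y) : R^o) x ->
  differentiable (fun y => complex.Re (g y) : R^o) x ->
  differentiable (fun y => complex.Im (g y) : R^o) x ->
  cderive (fun y => f y * g y) x v = f x * cderive g x v + g x * cderive f x v.
Proof.
move=> fr fi gr gi; rewrite /cderive.
pose f1 y : R^o := complex.Re (f y); pose f2 y : R^o := complex.Im (f y).
pose g1 y : R^o := complex.Re (g y); pose g2 y : R^o := complex.Im (g y).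
have -> : (fun y => complex.Re (f y * g y) : R^o) = (fun y => f1 y * g1 y : R^o) - (fun y => f2 y * g2 y : R^o).
  by apply/funext => y; rewrite /f1 /f2 /g1 /g2 !fctE; case: (f y) (g y) => [? ?] [? ?].
have -> : (fun y => complex.Im (f y * g y) : R^o) = (fun y => f1 y * g2 y : R^o) + (fun y => f2 y * g1 y : R^o).
  by apply/funext => y; rewrite /f1 /f2 /g1 /g2 !fctE; case: (f y) (g y) => [? ?] [? ?].
have dM (h k : V -> R^o) : differentiable h x -> differentiable k x ->
    derivable (fun y => h y * k y : R^o) x v.
  by move=> hd kd; exact: (diff_derivable (differentiableM hd kd)).
rewrite deriveB; [|exact: dM|exact: dM].
rewrite deriveD; [|exact: dM|exact: dM].
rewrite (deriveM_diff v fr gr) (deriveM_diff v fi gi) (deriveM_diff v fr gi) (deriveM_diff v fi gr).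
by case: (f x) (g x) => [? ?] [? ?]; apply: eq_complex_parts; rewrite /=; ring.
Qed.

Lemma dlogM {R : realType} {e} {M : smooth_space R e} (f g : M -> R[i]) ch x :
  is_manifold M -> csmooth f -> csmooth g -> (forall x, f x != 0) -> (forall x, g x != 0) ->
  atlas ch -> cdom ch x ->
  dlog (fun x => f x * g x) ch x = dlog f ch x + dlog g ch x.
Proof.
move=> Mm fs gs f0 g0 cha xc.
have [fr fi] := csmooth_diff fs cha xc; have [gr gi] := csmooth_diff gs cha xc.
apply/rowP => j; rewrite !mxE.
have := @cderiveM _ _ (f \o cinv ch) (g \o cinv ch) (cmap ch x) (delta_mx 0 j) fr fi gr gi.
rewrite [(f \o _) _]/= [(g \o _) (cmap _ _)]/= (cmapK Mm cha xc) => E.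
by rewrite -(dlog_identity _ _ (f0 x) (g0 x)) -E.
Qed.

Lemma pullbackD {R : realType} {e e'} {M : smooth_space R e} {N : smooth_space R e'} (f : M -> N)
    (A B : form1 N) ch x :
  pullback f (fun c x => A c x + B c x) ch x = pullback f A ch x + pullback f B ch x.
Proof. by apply/rowP => j; rewrite !mxE pairingDl. Qed.

Lemma eq_smooth_into {R : realType} {V : normedModType R} {e} {M : smooth_space R e} (S : set V)
    (f h : V -> M) : (forall x, S x -> f x = h x) -> smooth_into S f -> smooth_into S h.
Proof.
move=> fh fs x Sx; have [c [N [g [ca No gs fg]]]] := fs x Sx.
by exists c, N, g; split=> // y Sy Ny; rewrite -fh //; exact: fg.
Qed.

(** Values of [p] beyond [a] are arbitrary, so [p] is continuous at [a] from the left only. This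
    follows from the continuity of the local extension [g], carried back by [cinv c], and keeps [p]
    inside the region where a germ at [p a] is controlled. *)
Lemma smooth_into_left {R : realType} {e} {M : smooth_space R e} (Mm : is_manifold M) (k a : R)
    (p : R -> M) (P : set M) : k < a -> smooth_into (`[k, a] : set R) p -> nbhs (p a) P ->
  exists2 e, 0 < e & forall t, a - e < t -> t <= a -> P (p t).
Proof.
move=> ka ps nP.
have aS : `[k, a]%classic a by rewrite /= in_itv /= lexx ltW.
have [c [N [g [ca [No Na] gs pg]]]] := ps a aS.
have [ac ga] := pg a aS Na.
have n1 : \forall t \near a, P (cinv c (g t)).
  have ci : cimg c (g a) by rewrite -ga; exists (p a).
  have nQ : nbhs (g a) (cinv c @^-1` P).
    by apply: (cinv_continuous Mm ca ci); rewrite -ga (cmapK Mm).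
  exact: (smooth_on_continuous gs Na nQ).
have n2 := open_nbhs_nbhs (conj No Na).
have n3 : \forall t \near a, k < t by exact: lt_nbhsr.
have : \forall t \near a, t <= a -> P (p t).
  near=> t => ta; have tS : `[k, a]%classic t.
    by rewrite /= in_itv /= ta andbT ltW //; near: t.
  have Nt : N t by near: t.
  have [tc gt] := pg t tS Nt; rewrite -(cmapK Mm ca tc) gt.
  by near: t.
move=> /nbhs_ballP[e' /= e'0 eP]; exists e' => // t at_ ta.
apply: eP => //; rewrite -ball_normE /ball_ /= ger0_norm ?subr_ge0 //.
by rewrite ltrBlDr -ltrBlDl.
Unshelve. all: by end_near. Qed.

(** * Products of cochains and cohomology classes *)

Section CohomologyClasses.
Context {R : realType} {d : nat} {G : etale_groupoid R d}.
Implicit Types (c b : pre_cech1 G) (psi phi : pre_loop G).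

Let Om : is_manifold (ob G) := ob_manifold G.
Let Am : is_manifold (ar G) := ar_manifold G.

Lemma eq_pre_cech1 c c' : (forall g, c.1 g = c'.1 g) ->
  (forall ch x, c.2 ch x = c'.2 ch x) -> c = c'.
Proof.
case: c c' => [h A] [h' A'] /= hh AA; congr pair; first exact/funext.
by apply/funext => ch; apply/funext.
Qed.

Lemma cech1M c c' : cech1 c -> cech1 c' -> cech1 (cech1_mul c c').
Proof.
move=> [cs c0 cA] [cs' c0' cA']; split; first exact: csmoothM.
  by move=> g; rewrite mulf_neq0.
exact: is_form1D.
Qed.

Lemma cocycle1M c c' : cocycle1 c -> cocycle1 c' -> cocycle1 (cech1_mul c c').
Proof.
move=> cc cc'; have [c1 _ cf] := cc; have [c1' _ cf'] := cc'.
split; first exact: cech1M.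
- move=> g1 g2 g12; rewrite /= (cocycle1_mul cc g12) (cocycle1_mul cc' g12).
  have [[_ c0 _] [_ c0' _]] := (c1, c1').
  exact: cocycle_identity (c0 g1) (c0 g2) (c0' g1) (c0' g2).
- move=> ch g cha gc; have := cf ch g cha gc; have := cf' ch g cha gc.
  have [[cs c0 _] [cs' c0' _]] := (c1, c1').
  rewrite /= !pullbackD (dlogM Am cs cs' c0 c0' cha gc) => E' E.
  exact: cocycle_add E E'.
Qed.

Lemma coboundary1M b b' : coboundary1 b -> coboundary1 b' -> coboundary1 (cech1_mul b b').
Proof.
move=> [f [fs f0] [b1 b2]] [f' [fs' f0'] [b1' b2']].
exists (fun x => f x * f' x).
  by split; [exact: csmoothM|move=> x; rewrite mulf_neq0].
split; first by move=> g; rewrite /= b1 b1' /= invfM mulrACA.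
move=> ch x cha xc; rewrite /= (b2 ch x cha xc) (b2' ch x cha xc) /=.
by rewrite (dlogM Om fs fs' f0 f0' cha xc) opprD.
Qed.

Definition cech1_one : pre_cech1 G := (fun=> 1, fun _ _ => 0).

Lemma coboundary1_one : coboundary1 cech1_one.
Proof.
exists (fun=> 1); first by split=> [c ca|x]; [exact: csmooth_on_cst|exact: oner_neq0].
split=> [g|ch x cha xc]; first by rewrite /= invr1 mulr1.
apply/rowP => j; rewrite !mxE /cderive.
have -> : 'D_(delta_mx 0 j) (fun y : 'rV[R]_d => complex.Re (((fun=> 1) \o cinv ch) y : R[i]) : R^o) (cmap ch x) = 0.
  exact: derive_cst.
have -> : 'D_(delta_mx 0 j) (fun y : 'rV[R]_d => complex.Im (((fun=> 1) \o cinv ch) y : R[i]) : R^o) (cmap ch x) = 0.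
  exact: derive_cst.
by rewrite mulr0 oppr0.
Qed.

Lemma cech1_mul1 c : cech1_mul c cech1_one = c.
Proof. by apply: eq_pre_cech1 => [g|ch x]; rewrite /= ?mulr1 ?addr0. Qed.

Lemma cech1_mulACA c b c' b' : cech1_mul (cech1_mul c b) (cech1_mul c' b') =
  cech1_mul (cech1_mul c c') (cech1_mul b b').
Proof. by apply: eq_pre_cech1 => [g|ch x]; [exact: mulrACA|exact: addrACA]. Qed.

Lemma coclass_refl c : coclass c c.
Proof. by exists cech1_one; [exact: coboundary1_one|exact: cech1_mul1]. Qed.

Lemma class_mulE c c' :
  class_mul (coclass c) (coclass c') = coclass (cech1_mul c c').
Proof.
apply/seteqP; split=> [_ [_ [b bc <-] [_ [b' bc' <-] <-]]|_ [b bc <-]].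
  by rewrite cech1_mulACA; exists (cech1_mul b b') => //; exact: coboundary1M.
(* The whole coboundary is put into the first factor, and the second is represented by [c']
   itself. *)
exists (cech1_mul c b); first by exists b.
by exists c'; [exact: coclass_refl|rewrite -{1}(cech1_mul1 c') cech1_mulACA cech1_mul1].
Qed.

Lemma transgression_coclass c c' psi : cech1 c -> coclass c c' -> is_loop psi ->
  transgression c' psi = transgression c psi.
Proof.
move=> cc [b bc <-] psiL.
by rewrite (transgressionM cc (coboundary1_cech1 bc) psiL) (transgression_coboundary bc psiL) mulr1.
Qed.

(** The representative is chosen from [S] alone, independently of [psi], so on [hyper1] this is the
    transgression of one single cocycle and inherits the 0-cocycle property. Outside the classes of
    cocycles the value 1 is a default. *)
Definition transgression_class (S : set (pre_cech1 G)) psi : R[i] :=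
  if pselect (exists c, cocycle1 c /\ coclass c = S) is left e
  then transgression (projT1 (cid e)) psi else 1.

Lemma transgression_classE S : hyper1 S -> exists2 c, cocycle1 c /\ coclass c = S &
  transgression_class S = transgression c.
Proof.
move=> [c cc cS]; rewrite /transgression_class.
case: pselect => [e|]; last by case; exists c.
by case: (cid e) => c' /= c'P; exists c'.
Qed.

Lemma transgression_class_coclass c psi : cocycle1 c -> is_loop psi ->
  transgression_class (coclass c) psi = transgression c psi.
Proof.
move=> cc psiL; have [|c' [cc' c'c] ->] := @transgression_classE (coclass c).
  by exists c.
have [c1 _ _] := cc.
by apply: (transgression_coclass c1 _ psiL); rewrite -c'c; exact: coclass_refl.
Qed.

End CohomologyClasses.

(** * Naturality *)

Section Naturality.
Context {R : realType} {d' d : nat} {G' : etale_groupoid R d'} {G : etale_groupoid R d}.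
Context (F : smooth_functor G' G).

Let Om : is_manifold (ob G) := ob_manifold G.
Let Am : is_manifold (ar G) := ar_manifold G.
Let Om' : is_manifold (ob G') := ob_manifold G'.
Let Am' : is_manifold (ar G') := ar_manifold G'.

Lemma cech1_pullback_cech1 (c : pre_cech1 G) : cech1 c -> cech1 (cech1_pullback F c).
Proof.
move=> [cs c0 cA]; split.
- exact: (csmooth_comp Am' Am cs (far_smooth F)).
- by move=> g; exact: c0.
- exact: (pullback_form1 Om' Om (fob_smooth F) cA).
Qed.

(** The functor need not be étale, so [sigma] cannot be pushed forward. Instead [sigma'] is the
    target after a local inverse [r] of the source near [far F g]. For [x] the source of an arrow
    [y] near [g], [r] sends [fob F x] to [far F y], whose target is [fob F (sigma x)]. *)
Lemma germ_of_functor (g : ar G') (sigma : ob G' -> ob G') : germ_of g sigma ->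
  exists2 sigma', germ_of (far F g) sigma' &
    \forall x \near gsrc g, sigma' (fob F x) = fob F (sigma x).
Proof.
move=> sg.
have [U [r [[Uo Ug] _ _ _ rK]]] := @gsrc_etale _ _ G (far F g).
(* Continuity at [gsrc g] of the local inverse [r0] turns conditions on arrows near [g] into
   conditions on objects near [gsrc g]. *)
have [U0 [r0 [[U0o U0g] sU0 _ [r0c _] r0K]]] := @gsrc_etale _ _ G' g.
exists (fun x => gtgt (r x)).
  by apply: filterS (open_nbhs_nbhs (conj Uo Ug)) => y Uy; rewrite rK.
have xg : (gsrc (e := G') @` U0) (gsrc g) by exists g.
have r0g := r0c _ xg; have r0gE := r0K _ U0g.
have n1 : \forall y \near g, U (far F y).
  exact: ((far_smooth F).1 g I _ (open_nbhs_nbhs (conj Uo Ug))).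
have m1 : nbhs (r0 (gsrc g)) (far F @^-1` U) by rewrite r0gE.
have m2 : nbhs (r0 (gsrc g)) [set y | sigma (gsrc y) = gtgt y] by rewrite r0gE.
have n2 : \forall x \near gsrc g, U (far F (r0 x)) by exact: r0g m1.
have n3 : \forall x \near gsrc g, sigma (gsrc (r0 x)) = gtgt (r0 x) by exact: r0g m2.
have n4 := open_nbhs_nbhs (conj sU0 xg).
near=> x.
have [y U0y yx] : (gsrc (e := G') @` U0) x by near: x.
have r0x : r0 x = y by rewrite -yx r0K.
have Uy : U (far F y) by rewrite -r0x; near: x.
have sy : sigma (gsrc y) = gtgt y by rewrite -r0x; near: x.
by rewrite -yx sy -far_src rK // far_tgt.
Unshelve. all: by end_near. Qed.

(** The two germs are intertwined only near [gsrc g], which is [p a]; [smooth_into_left] tells how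
    long before [a] the path stays there, and the interval shrinks accordingly. *)
Lemma fits_smoothly_functor (g : ar G') (k a : R) (p q : R -> ob G') : k < a ->
  smooth_into (`[k, a] : set R) p -> gsrc g = p a -> fits_smoothly g a p q ->
  fits_smoothly (far F g) a (fob F \o p) (fob F \o q).
Proof.
move=> ka ps gp [sigma [sg [e e0 es]]].
have [sigma' sg' ss'] := germ_of_functor sg; rewrite gp in ss'.
have [e' e'0 e'P] := smooth_into_left Om' ka ps ss'.
exists sigma'; split=> //; exists (Num.min e e'); first by rewrite lt_min e0 e'0.
apply: (@eq_smooth_into _ _ _ _ _ (fob F \o (fun t => if t <= a then sigma (p t) else q t))).
  move=> t; rewrite /= in_itv /= => /andP[at_ _]; case: ifP => // ta.
  rewrite e'P //; apply: le_lt_trans at_.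
  by rewrite lerB // ge_min lexx orbT.
apply: (smooth_map_into Om' Om (fob_smooth F)).
apply: smooth_into_sub es => t; rewrite /= !in_itv /= => /andP[at_ ta]; apply/andP; split.
  by apply: le_lt_trans at_; rewrite lerB // ge_min lexx.
by apply: (lt_le_trans ta); rewrite lerD // ge_min lexx.
Qed.

Lemma loop_map_loop (psi : pre_loop G') : is_loop psi -> is_loop (loop_map F psi).
Proof.
move=> psiL W i iW; have [ps psrc ptgt pf] := psiL i iW; split.
- exact: (smooth_map_into Om' Om (fob_smooth F) ps).
- by rewrite /= far_src psrc.
- by rewrite /= far_tgt ptgt (next_piece_comp _ (fob F)).
- have -> : next_piece W (piece (loop_map F psi)) i =
      fob F \o next_piece (lpart psi) (piece psi) i.
    by apply/funext => t; rewrite /= (next_piece_comp _ (fob F)).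
  exact: (fits_smoothly_functor (knot_lt iW) ps psrc pf).
Qed.

(** A functor preserves sources and units, so [normalize] commutes with pullback; for the integrals
    this is the change of variables [path_integral_pullback]. *)
Lemma transgression_natural (c : pre_cech1 G) (psi : pre_loop G') : cech1 c -> is_loop psi ->
  transgression (cech1_pullback F c) psi = transgression c (loop_map F psi).
Proof.
move=> [cs c0 cA] psiL; rewrite /transgression !holonomyE.
apply: eq_bigr => i _; rewrite /hol_factor /=.
rewrite (path_integral_pullback Om' Om (fob_smooth F) (knot_lt (ltn_ord i)) cA
  (loop_piece_smooth psiL (ltn_ord i))).
by rewrite far_id far_src.
Qed.
End Naturality.

Theorem theorem1p0p1 (R : realType) :
  exists tau : forall (d : nat) (G : etale_groupoid R d),
      pre_cech1 G -> pre_loop G -> R[i],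
    (forall (d : nat) (G : etale_groupoid R d), leray G ->
      [/\ (forall c, cech1 c -> loop_cech0 (tau d G c)),
          (forall c c', cech1 c -> cech1 c' ->
             forall psi, is_loop psi ->
               tau d G (cech1_mul c c') psi = tau d G c psi * tau d G c' psi),
          (forall c, cocycle1 c ->
             forall psi, is_loop psi -> tau d G c psi = holonomy c psi),
          (forall c, cocycle1 c -> loop_cocycle0 (tau d G c)) /\
          (forall b, coboundary1 b ->
             forall psi, is_loop psi -> tau d G b psi = 1) &
          exists taubar : set (pre_cech1 G) -> pre_loop G -> R[i],
            [/\ (forall S, hyper1 S -> loop_cocycle0 (taubar S)),
                (forall S T, hyper1 S -> hyper1 T ->
                   forall psi, is_loop psi ->
                     taubar (class_mul S T) psi = taubar S psi * taubar T psi) &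
                (forall c, cocycle1 c ->
                   forall psi, is_loop psi ->
                     taubar (coclass c) psi = tau d G c psi)]]) /\
    (forall (d' d : nat) (G' : etale_groupoid R d') (G : etale_groupoid R d)
        (F : smooth_functor G' G), leray G' -> leray G ->
      [/\ (forall c, cech1 c -> cech1 (cech1_pullback F c)),
          (forall psi, is_loop psi -> is_loop (loop_map F psi)) &
          (forall c psi, cech1 c -> is_loop psi ->
             tau d' G' (cech1_pullback F c) psi = tau d G c (loop_map F psi))]).
Proof.
exists (fun d G => @transgression R d G); split=> [d G _|d' d G' G F _ _]; split.
- exact: transgression_cech0.
- by move=> c c' cc cc' psi psiL; exact: transgressionM.
- by move=> c cc psi _; exact: transgression_cocycle.
- split; first exact: transgression_cocycle0.
  by move=> b bc psi; exact: transgression_coboundary.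
- exists transgression_class; split.
  + by move=> S /transgression_classE[c [cc _] ->]; exact: transgression_cocycle0.
  + move=> _ _ [c cc <-] [c' cc' <-] psi psiL.
    rewrite class_mulE !transgression_class_coclass //; last exact: cocycle1M.
    by have [[c1 _ _] [c1' _ _]] := (cc, cc'); exact: transgressionM.
  + by move=> c cc psi; exact: transgression_class_coclass.
- exact: cech1_pullback_cech1.
- exact: loop_map_loop.
- by move=> c psi cc psiL; exact: transgression_natural.
Qed.
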